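(* Let $3\le p<q$ be relatively prime integers and let $H=\langle p,q,h_1,\dots,h_{n-2}\rangle\in KW(p,q)$ be of embedding dimension $n$. Then the following are equivalent: (1) $H\in KW_D(p,q)$. (2) There exist positive integers $x,y$ such that $(n-2)y\le p/2$, $(n-2)x\le q/2$, and $I_H$ is generated by the $2\times 2$ minors of the $2\times n$ matrix $$\begin{bmatrix} u_{n-2} & u^x & v^{p-(n-1)y} & u_1 & u_2 & \cdots & u_{n-4} & u_{n-3}\\ u^{q-(n-1)x} & v^y & u_1 & u_2 & u_3 & \cdots & u_{n-3} & u_{n-2}\end{bmatrix}.$$ (3) There exist $H$-homogeneous polynomials $F_1,\dots,F_n,G_1,\dots,G_n$ in the ideal $(u,v,u_1,\dots,u_{n-2})$ of $T=\Bbbk[u,v,u_1,\dots,u_{n-2}]$ such that $I_H$ is generated by the $2\times 2$ minors of the matrix $$\begin{bmatrix} F_1 & F_2 & \cdots & F_n\\ G_1 & G_2 & \cdots & G_n\end{bmatrix}.$$ (4) $\mathrm{PF}(H)=\{z+k,z+2k,\dots,z+(n-1)k\}$ for some $z\ge 0$ and $k>0$. Moreover, when this is the case, $\mathrm{PF}(H)=\{pq-(ix+1)p-((n-i-2)y+1)q \mid 0\le i\le n-2\}$, where $x,y$ are the positive integers defining $H$ as an element of $KW_D(p,q)$, and hence the $k$ in (4) equals $|xp-yq|$.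
   Context: $\langle a_1,\dots,a_k\rangle$ denotes the additive submonoid of $\mathbb{N}$ (with $0$) generated by $a_1,\dots,a_k$. For relatively prime integers $3\le p<q$, $KW(p,q)$ is the class of numerical semigroups $H=\langle p,q,h_1,\dots,h_{n-2}\rangle$ ($n\ge 3$) with $h_i=pq-x_ip-y_iq$ for integers $0<x_1<\dots<x_{n-2}\le q/2$ and $p/2\ge y_1>\dots>y_{n-2}>0$; the number $n$ is the embedding dimension (number of minimal generators) of $H$. $KW_D(p,q)$ is the subclass of those $H\in KW(p,q)$ for which there exist positive integers $x,y$ with $(n-2)x\le q/2$, $(n-2)y\le p/2$, and $x_i=ix$, $y_i=(n-1-i)y$ for all $1\le i\le n-2$; these $x,y$ are ''the integers defining $H$ as an element of $KW_D(p,q)$''. Fix a field $\Bbbk$. The ring $T=\Bbbk[u,v,u_1,\dots,u_{n-2}]$ is graded by $\deg u=p$, $\deg v=q$, $\deg u_i=h_i$; a polynomial is $H$-homogeneous if it is homogeneous for this grading. The defining ideal $I_H$ is the kernel of the $\Bbbk$-algebra homomorphism $T\to\Bbbk[t]$, $u\mapsto t^p$, $v\mapsto t^q$, $u_i\mapsto t^{h_i}$. The columns of the matrix in (2) are (top, bottom): $(u_{n-2},u^{q-(n-1)x})$, $(u^x,v^y)$, $(v^{p-(n-1)y},u_1)$, and $(u_i,u_{i+1})$ for $i=1,\dots,n-3$. $\mathrm{PF}(H)$ is the set of pseudo-Frobenius numbers of $H$: integers $g\notin H$ such that $g+s\in H$ for all $s\in H\setminus\{0\}$.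
   Formalization: For n=3 the formal statement also assumes x_1 ≠ q/2 and y_1 ≠ p/2; in those boundary cases the equivalence fails, e.g. H=⟨4,5,6⟩ (p=4, q=5, x_1=1, y_1=2) is in KW_D(p,q) but PF(H)={7}. *)

(* Defs.v *)
From HB Require Import structures.
From mathcomp Require Import all_boot all_order all_algebra.
From mathcomp Require Import mpoly.

Set Implicit Arguments.
Unset Strict Implicit.
Unset Printing Implicit Defensive.

Import GRing.Theory.

Local Open Scope ring_scope.

Definition monoid_gen (k : nat) (a : 'I_k -> nat) (s : nat) : Prop :=
  exists c : 'I_k -> nat, s = (\sum_(i < k) c i * a i)%N.

Definition min_generator (H : nat -> Prop) (s : nat) : Prop :=
  [/\ H s, s <> 0%N &
      forall a b : nat, H a -> H b -> s = (a + b)%N -> a = 0%N \/ b = 0%N].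

Definition embedding_dim (H : nat -> Prop) (n : nat) : Prop :=
  exists s : seq nat,
    [/\ uniq s, size s = n & forall a : nat, a \in s <-> min_generator H a].

Definition in_semigroup (H : nat -> Prop) (g : int) : Prop :=
  exists2 s : nat, H s & g = s%:Z.

Definition PF (H : nat -> Prop) (g : int) : Prop :=
  ~ in_semigroup H g /\
  forall s : nat, H s -> s <> 0%N -> in_semigroup H (g + s%:Z).

(* Sequences x_1, ..., x_(n-2) are functions nat -> nat of which only the
   values at 1, ..., n-2 matter.  When x_i <= q/2 and y_i <= p/2 the
   subtractions below are not truncated. *)
Definition KWh (p q : nat) (xs ys : nat -> nat) (i : nat) : nat :=
  (p * q - xs i * p - ys i * q)%N.

(* The tuple (p, q, h_1, ..., h_(n-2)), indexed from 0. *)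
Definition KWgens (p q n : nat) (xs ys : nat -> nat) (j : 'I_n) : nat :=
  match val j with
  | 0 => p
  | 1 => q
  | i.+1 => KWh p q xs ys i
  end.

(* H belongs to KW(p,q), has embedding dimension n, and is presented by the
   coefficients xs, ys.  A bound a <= b/2 is written 2 * a <= b. *)
Definition in_KW (p q n : nat) (xs ys : nat -> nat) (H : nat -> Prop) : Prop :=
  [/\ (3 <= n)%N,
      forall i, (1 <= i <= n - 2)%N ->
        [/\ (0 < xs i)%N, (2 * xs i <= q)%N, (0 < ys i)%N & (2 * ys i <= p)%N],
      forall i j, (1 <= i)%N -> (i < j)%N -> (j <= n - 2)%N ->
        (xs i < xs j)%N /\ (ys j < ys i)%N,
      forall s, H s <-> monoid_gen (@KWgens p q n xs ys) s &
      embedding_dim H n].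

(* x, y are the integers defining H as an element of KW_D(p,q). *)
Definition KWD_integers (p q n : nat) (H : nat -> Prop) (x y : nat) : Prop :=
  [/\ (0 < x)%N, (0 < y)%N,
      (2 * ((n - 2) * x) <= q)%N, (2 * ((n - 2) * y) <= p)%N &
      exists xs ys : nat -> nat, in_KW p q n xs ys H /\
        forall i, (1 <= i <= n - 2)%N ->
          xs i = (i * x)%N /\ ys i = ((n - 1 - i) * y)%N].

Definition in_KWD (p q n : nat) (H : nat -> Prop) : Prop :=
  exists x y : nat, KWD_integers p q n H x y.

Definition ideal_gen (R : comNzRingType) (S : R -> Prop) (f : R) : Prop :=
  exists (k : nat) (c g : 'I_k -> R),
    (forall i, S (g i)) /\ f = \sum_(i < k) c i * g i.

Definition two_rows (R : Type) (n : nat) (F G : 'I_n -> R) : 'M[R]_(2, n) :=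
  \matrix_(r < 2, j < n) if r == ord0 then F j else G j.

Definition minor2 (R : comNzRingType) (n : nat) (M : 'M[R]_(2, n)) (f : R) :
    Prop :=
  exists i j : 'I_n, (i < j)%N /\
    f = \det (colsub (fun k : 'I_2 => if k == ord0 then i else j) M).

(* In {mpoly K[n]} the variables u, v, u_1, ..., u_(n-2) are the variables of
   index 0, 1, 2, ..., n-1; an index out of range gives 0. *)
Definition mvar (K : fieldType) (n i : nat) : {mpoly K[n]} :=
  if insub i is Some j then 'X_j else 0.

Definition var_u (K : fieldType) (n : nat) : {mpoly K[n]} := mvar K n 0.
Definition var_v (K : fieldType) (n : nat) : {mpoly K[n]} := mvar K n 1.
Definition var_ui (K : fieldType) (n i : nat) : {mpoly K[n]} := mvar K n i.+1.

Definition irrelevant_ideal (K : fieldType) (n : nat) (f : {mpoly K[n]}) :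
    Prop :=
  ideal_gen (fun g => exists i : 'I_n, g = 'X_i) f.

(* The kernel of the K-algebra morphism 'X_i |-> t^(a i). *)
Definition defining_ideal (K : fieldType) (n : nat) (a : 'I_n -> nat)
    (f : {mpoly K[n]}) : Prop :=
  mmap (@polyC K) (fun i => 'X^(a i)) f = 0 :> {poly K}.

Definition wdeg (n : nat) (a : 'I_n -> nat) (m : 'X_{1..n}) : nat :=
  (\sum_(i < n) m i * a i)%N.

Lemma wdeg0 (n : nat) (a : 'I_n -> nat) : wdeg a 0%MM = 0%N.
Proof. by rewrite /wdeg big1 // => i _; rewrite mnm0E. Qed.

Lemma wdegD (n : nat) (a : 'I_n -> nat) :
  {morph wdeg a : m1 m2 / (m1 + m2)%MM >-> (m1 + m2)%N}.
Proof.
by move=> m1 m2; rewrite /wdeg -big_split /=; apply: eq_bigr => i _;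
  rewrite mnmDE mulnDl.
Qed.

HB.instance Definition _ (n : nat) (a : 'I_n -> nat) :=
  isMeasure.Build n (wdeg a) (wdeg0 a) (wdegD a).

Definition whomog (K : fieldType) (n : nat) (a : 'I_n -> nat)
    (f : {mpoly K[n]}) : Prop :=
  exists d : nat, f \is ishomog1 d (wdeg a).

(* If n >= 3, 2(n-2)x <= q and 2(n-2)y <= p, then (n-1)x <= q and (n-1)y <= p,
   so the exponents below are not truncated. *)
Definition KWD_matrix (K : fieldType) (p q n x y : nat) :
    'M[{mpoly K[n]}]_(2, n) :=
  two_rows
    (fun j : 'I_n =>
       match val j with
       | 0 => var_ui K n (n - 2)
       | 1 => var_u K n ^+ x
       | 2 => var_v K n ^+ (p - (n - 1) * y)
       | i.+2 => var_ui K n i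
       end)
    (fun j : 'I_n =>
       match val j with
       | 0 => var_u K n ^+ (q - (n - 1) * x)
       | 1 => var_v K n ^+ y
       | i.+1 => var_ui K n i
       end).

(* Main.v *)
(* Write h_i = pq - X_i p - Y_i q with (X_0, Y_0) = (0, p) and
   (X_(n-1), Y_(n-1)) = (q, 0). The integers pq - A p - B q with A, B > 0 that lie
   in H are those with A <= X_i, B <= Y_i for some i, so the elements of PF(H) are
   e_j - p - q with e_j = pq - X_j p - Y_(j+1) q, one for each inner corner of this
   staircase. If they form an arithmetic progression, then 2 e_b = e_a + e_c forces
   2 X_b = X_a + X_c modulo q, hence exactly, which gives (4) => (1).

   (1) => (2): modulo the minors every monomial reduces to u^a v^b or u^a v^b u_k,
   and two such normal forms of the same degree are congruent.

   (3) => (4): for n = 3 condition (1) always holds. If n >= 4, I_H has C(n,2)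
   minimal generators, of degrees h_i + h_j (0 < i <= j < n-1) and
   e_j. There are as many minors, so they form a minimal generating set as well;
   hence the minors are homogeneous, deg F_i - deg G_i = delta does not depend on
   i, and the multiset {deg F_i + deg G_j | i < j} is that of the generator
   degrees. Since u_i^2 occurs in some minor, h_i is both some deg F_j and some
   deg G_k with k <> j. So the deg G_j are the h_i and two further numbers c1, c2,
   and the deg F_j are the h_i and two further numbers d1, d2. In terms of the
   generating functions in z, the equality of multisets becomes
   (z^delta - 1) sum_j z^(e_j) = z^(d1 + d2) - z^(delta + c1 + c2),
   so the e_j form an arithmetic progression with difference delta. *)
Require Import Defs.
From mathcomp Require Import all_boot all_order all_algebra.
From mathcomp Require Import mpoly perm.
From mathcomp Require Import zify ring.

Set Implicit Arguments.
Unset Strict Implicit.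
Unset Printing Implicit Defensive.

Import GRing.Theory Num.Theory.

Local Open Scope ring_scope.

(** * Arithmetic of the semigroup and its pseudo-Frobenius numbers *)

(** The delicate point is that an arbitrary generating family of minors reproduces the degrees of
    the generators, although only its entries are known to be homogeneous. Set the variables outside
    a set J to 0 in the parametrisation and read off the coefficient of t^d: if no monomial of
    degree d mixes J with its complement, this linear form kills the product of the irrelevant ideal
    and I_H. For each binomial generator a J containing the support of exactly one of its two
    monomials gives a dual family of such forms. Their matrix on the minors is invertible, and a
    nonzero term of its determinant matches minors with generators. The sets J exist because certain
    differences of degrees are not in H, which is read off the coordinates (A, B) of pq - A p - B q,
    unique up to multiples of (q, -p). The bounds q/2 and p/2 can be attained only by X_m and Y_1;
    when m = n - 2 = 1 both concern the same point, and the strictness needed for m >= 2 is lost.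
    For (2) => (3) the entries must not be units. A degree comparison gives x = x_1 and y =
    y_(1)/(n-2), so the excluded boundary cases for n = 3 make both exponents positive. *)

Lemma lin_comb_coprime (p q : nat) (A B : int) :
  coprime p q -> A * p%:Z + B * q%:Z = 0 -> (0 < q)%N ->
  exists t : int, A = t * q%:Z /\ B = - (t * p%:Z).
Proof.
move=> cpq E q0.
have : (q%:Z %| A * p%:Z)%Z.
  by apply/dvdzP; exists (- B); lia.
rewrite Gauss_dvdzl; last by rewrite coprimezE /= coprime_sym.
case/dvdzP=> t tE; exists t; split=> //.
have : (B + t * p%:Z) * q%:Z = 0 by rewrite -E tE; ring.
by move/eqP; rewrite mulf_eq0; case/orP => /eqP; lia.
Qed.


(** Either bound forces the multiple of (q, -p) to be zero. This turns equalities of degrees into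
    equalities of coordinates. *)
Lemma coord_uniq (p q : nat) (A B : int) :
  coprime p q -> (0 < q)%N -> A * p%:Z + B * q%:Z = 0 ->
  (- q%:Z < A < q%:Z) || (- p%:Z < B < p%:Z) -> A = 0 /\ B = 0.
Proof.
move=> cpq q0 E lt.
have [t [EA EB]] := lin_comb_coprime cpq E q0.
suff t0 : t = 0 by rewrite EA EB t0; split; ring.
have ? : ~ 1 <= t by move=> t1; case/orP: lt; nia.
have ? : ~ t <= -1 by move=> t1; case/orP: lt; nia.
lia.
Qed.

(* The points (X i, Y i), 0 < i <= m, are the coefficients (x_i, y_i), completed
   by (0, p) and (q, 0), which represent the element 0 of the semigroup. *)
Definition staircase (p q m : nat) (X Y : nat -> nat) : Prop :=
  [/\ coprime p q, (0 < m)%N,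
      [/\ X 0 = 0, Y 0 = p, X m.+1 = q & Y m.+1 = 0]%N,
      forall i j, (i < j)%N -> (j <= m.+1)%N -> (X i < X j)%N /\ (Y j < Y i)%N &
      forall i, (1 <= i <= m)%N -> (2 * X i <= q)%N /\ (2 * Y i <= p)%N].

(** One h_i at most suffices: by the half bounds a sum of two of them already lies in <p, q>. The
    index 0 stands for the element 0, so it contributes <p, q> itself. *)
Definition stair_sg (p q m : nat) (X Y : nat -> nat) (g : int) : Prop :=
  exists i a b : nat, (i <= m)%N /\
    g = p%:Z * q%:Z - (X i)%:Z * p%:Z - (Y i)%:Z * q%:Z + a%:Z * p%:Z + b%:Z * q%:Z.

Section Staircase.
Variables (p q m : nat) (X Y : nat -> nat).
Hypothesis st : staircase p q m X Y.
Local Notation sg := (stair_sg p q m X Y).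
Local Notation pt A B := (p%:Z * q%:Z - A * p%:Z - B * q%:Z).

Lemma stair_cop : coprime p q. Proof. by case: st. Qed.
Lemma stair_m : (0 < m)%N. Proof. by case: st. Qed.
Lemma stair_X0 : X 0 = 0%N. Proof. by case: st => _ _ []. Qed.
Lemma stair_Y0 : Y 0 = p. Proof. by case: st => _ _ []. Qed.
Lemma stair_Xm : X m.+1 = q. Proof. by case: st => _ _ []. Qed.
Lemma stair_Ym : Y m.+1 = 0%N. Proof. by case: st => _ _ []. Qed.
Lemma stair_X i j : (i < j)%N -> (j <= m.+1)%N -> (X i < X j)%N.
Proof. by case: st => _ _ _ + _ ij jm => /(_ i j ij jm) []. Qed.
Lemma stair_Y i j : (i < j)%N -> (j <= m.+1)%N -> (Y j < Y i)%N.
Proof. by case: st => _ _ _ + _ ij jm => /(_ i j ij jm) []. Qed.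
Lemma stair_X2 i : (i <= m)%N -> (2 * X i <= q)%N.
Proof.
case: i => [|i] im; first by rewrite stair_X0.
by case: st => _ _ _ _ /(_ i.+1 im) [].
Qed.
Lemma stair_Y2 i : (1 <= i <= m.+1)%N -> (2 * Y i <= p)%N.
Proof.
case/andP=> i1; rewrite leq_eqVlt => /orP[/eqP->|im]; first by rewrite stair_Ym.
by case: st => _ _ _ _ /(_ i); rewrite i1 => /(_ im) [].
Qed.
Lemma stair_Xle i j : (i <= j)%N -> (j <= m.+1)%N -> (X i <= X j)%N.
Proof. by rewrite leq_eqVlt => /orP[/eqP->//|ij] jm; apply/ltnW/stair_X. Qed.
Lemma stair_Yle i j : (i <= j)%N -> (j <= m.+1)%N -> (Y j <= Y i)%N.
Proof. by rewrite leq_eqVlt => /orP[/eqP->//|ij] jm; apply/ltnW/stair_Y. Qed.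
Lemma stair_q : (0 < q)%N.
Proof. by have := @stair_X 0 m.+1 isT (leqnn _); rewrite stair_X0 stair_Xm. Qed.
Lemma stair_p : (0 < p)%N.
Proof. by have := @stair_Y 0 m.+1 isT (leqnn _); rewrite stair_Y0 stair_Ym. Qed.

Lemma stair_sgD g (a b : nat) : sg g -> sg (g + a%:Z * p%:Z + b%:Z * q%:Z).
Proof.
case=> i [c [d [im ->]]]; exists i, (a + c)%N, (b + d)%N; split=> //.
by rewrite !PoszD; ring.
Qed.

Lemma stair_sg_pure (A B : int) : A <= 0 -> B <= p%:Z -> sg (pt A B).
Proof.
move=> A0 Bp; exists 0%N, `|A|%N, `|p%:Z - B|%N; split=> //.
rewrite stair_X0 stair_Y0.
have -> : `|A|%N%:Z = - A by lia.
have -> : `|p%:Z - B|%N%:Z = p%:Z - B by lia.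
by ring.
Qed.

Lemma stair_sg_pure' (A B : int) : B <= 0 -> A <= q%:Z -> sg (pt A B).
Proof.
move=> A0 Bp; exists 0%N, `|q%:Z - A|%N, `|B|%N; split=> //.
rewrite stair_X0 stair_Y0.
have -> : `|B|%N%:Z = - B by lia.
have -> : `|q%:Z - A|%N%:Z = q%:Z - A by lia.
by ring.
Qed.

Lemma stair_sg_below i (A B : int) : (i <= m)%N ->
  A <= (X i)%:Z -> B <= (Y i)%:Z -> sg (pt A B).
Proof.
move=> im AX BY; exists i, `|(X i)%:Z - A|%N, `|(Y i)%:Z - B|%N; split=> //.
have -> : `|(X i)%:Z - A|%N%:Z = (X i)%:Z - A by lia.
have -> : `|(Y i)%:Z - B|%N%:Z = (Y i)%:Z - B by lia.
by ring.
Qed.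

(** Two coordinate pairs of one integer differ by t (q, -p). For i >= 1, A >= 1 and 2 X_i <= q give
    t >= 0, while B >= 1 and 2 Y_i <= p give t <= 0; for i = 0 no t is possible. *)
Lemma stair_sgP (A B : int) : 1 <= A -> 1 <= B -> sg (pt A B) ->
  exists i, [/\ (1 <= i <= m)%N, A <= (X i)%:Z & B <= (Y i)%:Z].
Proof.
move=> A1 B1 [i [a [b [im E]]]].
have {}E : (A + a%:Z - (X i)%:Z) * p%:Z + (B + b%:Z - (Y i)%:Z) * q%:Z = 0.
  by move/eqP: E; rewrite -subr_eq0 => /eqP E; rewrite -[RHS]oppr0 -E; ring.
case: i im E => [|i] im E.
  rewrite stair_X0 stair_Y0 in E.
  have [t [EA EB]] := lin_comb_coprime stair_cop E stair_q.
  have := stair_p; have := stair_q => q0 p0.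
  have : 0 < t by nia.
  by nia.
have := stair_X2 im; have := @stair_Y2 i.+1 (leqW im) => Y2 X2.
have [t [EA EB]] := lin_comb_coprime stair_cop E stair_q.
have := stair_p; have := stair_q => q0 p0.
have ? : t <= 0 by nia.
have ? : 0 <= t by nia.
have t0 : t = 0 by lia.
rewrite t0 in EA EB.
exists i.+1; split=> //; lia.
Qed.

Lemma stair_coords (g : int) : exists A B : int, g = pt A B /\ 1 <= B <= p%:Z.
Proof.
have p0 := stair_p.
have /coprimezP [[u v] /= uv] : coprimez p%:Z q%:Z.
  by rewrite coprimezE /= stair_cop.
(* B has to be congruent to -v g modulo p; the shift by 1 puts the representative r + 1 in [1, p]
   instead of [0, p - 1]. *)
pose b := - (v * g) - 1.
have := divz_eq b p%:Z.
have := @modz_ge0 b p%:Z; have := @ltz_pmod b p%:Z.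
move: (b %/ p%:Z)%Z (b %% p%:Z)%Z => t r r1 r2 E.
have pp : 0 < p%:Z by [].
have {}r1 := r1 pp; have {}r2 : 0 <= r by apply: r2; lia.
exists (q%:Z - u * g + t * q%:Z), (r + 1); split; last by lia.
have -> : r = - (v * g) - 1 - t * p%:Z by rewrite -/b E; ring.
transitivity (g * (u * p%:Z + v * q%:Z)); first by rewrite uv mulr1.
by ring.
Qed.

Lemma stair_corner_notin j : (j <= m)%N ->
  ~ sg (pt ((X j)%:Z + 1) ((Y j.+1)%:Z + 1)).
Proof.
move=> jm /stair_sgP [||i [/andP[i1 im] Xij Yij]]; try lia.
have ji : (j < i)%N.
  rewrite ltnNge; apply/negP => ij.
  by have := stair_Xle ij (leqW jm); lia.
by have := stair_Yle ji (leqW im); lia.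
Qed.

Lemma stair_corner_q j : (j <= m)%N -> sg (pt ((X j)%:Z + 1) (Y j.+1)%:Z).
Proof.
rewrite leq_eqVlt => /orP[/eqP->|jm].
  rewrite stair_Ym; apply: stair_sg_pure' => //.
  by have := @stair_X m m.+1 (leqnn _) (leqnn _); rewrite stair_Xm; lia.
apply: (@stair_sg_below j.+1) => //.
by have := @stair_X j j.+1 (leqnn _) (leqW jm); lia.
Qed.

Lemma stair_corner_p j : (j <= m)%N -> sg (pt (X j)%:Z ((Y j.+1)%:Z + 1)).
Proof.
move=> jm; apply: (@stair_sg_below j) => //.
by have := @stair_Y j j.+1 (leqnn _) jm; lia.
Qed.

(** Subtracting q from the first coordinate of the sum lands in <p, q> unless a coordinate
    overflows. Overflow in X forces i = j = m with X_m = q/2, overflow in Y forces i = j + 1 = 1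
    with Y_1 = p/2; the neighbouring point m - 1 or 2 then covers the sum. For m = 1 there is no
    neighbour, hence the hypothesis. *)
Lemma stair_corner_h i j :
  (m = 1%N -> (2 * X 1 <> q)%N /\ (2 * Y 1 <> p)%N) ->
  (1 <= i <= m)%N -> (j <= m)%N ->
  sg (pt ((X j)%:Z + 1) ((Y j.+1)%:Z + 1) + pt (X i)%:Z (Y i)%:Z).
Proof.
move=> nb /andP[i1 im] jm.
have Xi := stair_X2 im; have Xj := stair_X2 jm.
have Yi := @stair_Y2 i; rewrite i1 leqW // in Yi; have {}Yi := Yi isT.
have Yj := @stair_Y2 j.+1; rewrite /= ltnS jm in Yj; have {}Yj := Yj isT.
have [Xs|Xs] := leqP (X j + 1 + X i) q; last first.
  have ij : i = j.
    have ? : X i = X j by lia.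
    apply/eqP; rewrite eqn_leq; apply/andP; split; rewrite leqNgt; apply/negP.
      by move=> /stair_X /(_ (leqW im)); lia.
    by move=> /stair_X /(_ (leqW jm)); lia.
  subst j.
  have {}im' : i = m.
    apply/eqP; rewrite eqn_leq im leqNgt; apply/negP => /stair_X /(_ (leqnSn _)).
    by have := stair_X2 (leqnn m); lia.
  subst i.
  rewrite stair_Ym.
  have -> : pt ((X m)%:Z + 1) (0 + 1) + pt (X m)%:Z (Y m)%:Z
          = pt ((X m)%:Z + 1 + (X m)%:Z - q%:Z) ((Y m)%:Z + 1) by ring.
  have [m1|m2] : m = 1%N \/ (1 < m)%N by lia.
    by case: (nb m1); rewrite m1 in Xs Xi; lia.
  apply: (@stair_sg_below m.-1); first by lia.
    have : (0 < X m.-1)%N by rewrite -stair_X0; apply: stair_X; lia.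
    by lia.
  have := @stair_Y m.-1 m; lia.
have [Ys|Ys] := leqP (Y j.+1 + 1 + Y i) p; last first.
  have ij : i = j.+1.
    have ? : Y i = Y j.+1 by lia.
    apply/eqP; rewrite eqn_leq; apply/andP; split; rewrite leqNgt; apply/negP.
      by move=> /stair_Y /(_ (leqW im)); lia.
    by move=> /stair_Y /(_ jm); lia.
  subst i.
  have j0 : j = 0%N.
    apply/eqP; rewrite -leqn0 leqNgt; apply/negP => j0.
    have /stair_Y : (1 < j.+1)%N by [].
    move=> /(_ jm); have := @stair_Y2 1; lia.
  subst j; rewrite stair_X0.
  have -> : pt (0 + 1) ((Y 1)%:Z + 1) + pt (X 1)%:Z (Y 1)%:Z
          = pt ((X 1)%:Z + 1) ((Y 1)%:Z + 1 + (Y 1)%:Z - p%:Z) by ring.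
  have [m1|m2] : m = 1%N \/ (1 < m)%N by lia.
    by case: (nb m1); lia.
  apply: (@stair_sg_below 2) => //.
    have := @stair_X 1 2; lia.
  have : (Y 3 < Y 2)%N by apply: stair_Y.
  by lia.
have -> : pt ((X j)%:Z + 1) ((Y j.+1)%:Z + 1) + pt (X i)%:Z (Y i)%:Z
  = pt ((X j)%:Z + 1 + (X i)%:Z - q%:Z) ((Y j.+1)%:Z + 1 + (Y i)%:Z) by ring.
by apply: stair_sg_pure; lia.
Qed.

(** For a pseudo-Frobenius g with coordinates (A, B), membership of g + p gives a point with A = X_i
    + 1 and B <= Y_i, and membership of g + q a point with B = Y_k + 1 and A <= X_k. A point
    strictly between i and k would cover g, so k = i + 1. The values A = 1 and B = 1 use the added
    points 0 and m + 1. *)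
Lemma stair_PF (g : int) :
  (m = 1%N -> (2 * X 1 <> q)%N /\ (2 * Y 1 <> p)%N) ->
  (~ sg g /\ forall s : nat, sg s%:Z -> s <> 0%N -> sg (g + s%:Z)) <->
  exists2 j : nat, (j <= m)%N & g = pt ((X j)%:Z + 1) ((Y j.+1)%:Z + 1).
Proof.
move=> nb; split; last first.
  case=> j jm ->; split; first exact: stair_corner_notin.
  move=> s [i [a [b [im sE]]]] s0.
  case: i im sE => [|i] im sE; last first.
    rewrite sE !addrA.
    have := @stair_corner_h i.+1 j nb im jm => /(stair_sgD a b).
    by rewrite !addrA.
  rewrite stair_X0 stair_Y0 in sE.
  have {}sE : s%:Z = a%:Z * p%:Z + b%:Z * q%:Z by rewrite sE; ring.
  rewrite sE; case: a sE => [|a] sE.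
    case: b sE => [|b] sE; first by lia.
    have := stair_sgD 0 b (stair_corner_q jm).
    by congr sg; rewrite -(addn1 b) PoszD; ring.
  have := stair_sgD a b (stair_corner_p jm).
  by congr sg; rewrite -(addn1 a) PoszD; ring.
have [A [B [-> /andP[B1 Bp]]]] := stair_coords g.
case=> notin gs.
have A1 : 1 <= A.
  have [//|A0] : 1 <= A \/ A <= 0 by lia.
  by case: notin; apply: stair_sg_pure.
have nle i : (i <= m)%N -> A <= (X i)%:Z -> B <= (Y i)%:Z -> False.
  by move=> im AX BY; apply: notin; apply: stair_sg_below im AX BY.
have p0 := stair_p; have q0 := stair_q.
have sgp : sg (pt (A - 1) B).
  have := gs p; rewrite (_ : _ + p%:Z = pt (A - 1) B); last by ring.
  apply; last by lia.
  exists 0%N, 1%N, 0%N; split=> //; rewrite stair_X0 stair_Y0; ring.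
have sgq : sg (pt A (B - 1)).
  have := gs q; rewrite (_ : _ + q%:Z = pt A (B - 1)); last by ring.
  apply; last by lia.
  exists 0%N, 0%N, 1%N; split=> //; rewrite stair_X0 stair_Y0; ring.
have [i [im AE BY]] : exists i, [/\ (i <= m)%N, A = (X i)%:Z + 1 & B <= (Y i)%:Z].
  have [A1'|A2] : A = 1 \/ 1 <= A - 1 by lia.
    by exists 0%N; rewrite stair_X0 stair_Y0 A1'; split.
  have [i [/andP[i1 im] AX BY]] := stair_sgP A2 B1 sgp.
  exists i; split=> //.
  have ? : ~ A <= (X i)%:Z by move/(nle i im); apply.
  by lia.
have Xim := @stair_X i m.+1 im (leqnn _); rewrite stair_Xm in Xim.
have [k [km AX BE]] : exists k, [/\ (1 <= k <= m.+1)%N, A <= (X k)%:Z & B = (Y k)%:Z + 1].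
  have [B1'|B2] : B = 1 \/ 1 <= B - 1 by lia.
    by exists m.+1; rewrite stair_Xm stair_Ym B1' AE; split=> //; lia.
  have [k [/andP[k1 km] AX BY']] := stair_sgP A1 B2 sgq.
  exists k; split=> //; first by lia.
  have ? : ~ B <= (Y k)%:Z by apply: nle.
  by lia.
exists i => //; rewrite AE BE; suff -> : k = i.+1 by [].
have ik : (i < k)%N.
  rewrite ltnNge; apply/negP => ki; have := stair_Xle ki (leqW im); lia.
apply/eqP; rewrite eqn_leq ik andbT leqNgt; apply/negP => ik'.
have im' : (i.+1 <= m)%N by lia.
apply: (nle i.+1 im').
  by have := @stair_X i i.+1 (leqnn _) (leqW im'); lia.
by have := @stair_Y i.+1 k ik'; lia.
Qed.

End Staircase.

(** * Closure under addition, and differences of degrees that lie outside the semigroup *)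

Section Staircase2.
Variables (p q m : nat) (X Y : nat -> nat).
Hypothesis st : staircase p q m X Y.
Local Notation sg := (stair_sg p q m X Y).
Local Notation pt A B := (p%:Z * q%:Z - A * p%:Z - B * q%:Z).
Local Notation h i := (pt (X i)%:Z (Y i)%:Z).
Local Notation e j := (pt (X j)%:Z (Y j.+1)%:Z).

Lemma stair_sg0 : sg 0.
Proof.
by exists 0%N, 0%N, 0%N; rewrite (stair_X0 st) (stair_Y0 st); split=> //; ring.
Qed.

Lemma stair_sg_h i : (i <= m)%N -> sg (h i).
Proof. by move=> im; apply: stair_sg_below im _ _. Qed.

Lemma stair_sg_add g g' : sg g -> sg g' -> sg (g + g').
Proof.
case=> i [a [b [im ->]]] [j [c [d [jm ->]]]].
case: i im => [|i] im.
  have := stair_sgD (a + c) (b + d) (stair_sg_h jm).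
  by congr sg; rewrite (stair_X0 st) (stair_Y0 st) !PoszD; ring.
case: j jm => [|j] jm.
  have := stair_sgD (a + c) (b + d) (stair_sg_h im).
  by congr sg; rewrite (stair_X0 st) (stair_Y0 st) !PoszD; ring.
have Xi := stair_X2 st im; have Xj := stair_X2 st jm.
have Yi := @stair_Y2 _ _ _ _ _ st i.+1 (leqW im).
have Yj := @stair_Y2 _ _ _ _ _ st j.+1 (leqW jm).
have := stair_sgD (a + c) (b + d) (@stair_sg_pure _ _ _ _ _ st
  ((X i.+1)%:Z + (X j.+1)%:Z - q%:Z) ((Y i.+1)%:Z + (Y j.+1)%:Z) _ _).
rewrite !PoszD => H.
have {}H := H ltac:(lia) ltac:(lia).
by move: H; congr sg; ring.
Qed.

Lemma stair_sg_bound (A B : int) : 1 <= A -> 1 <= B ->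
  (q%:Z < 2 * A) || (p%:Z < 2 * B) -> ~ sg (pt A B).
Proof.
move=> A1 B1 lt /(stair_sgP st A1 B1) [k [/andP[k1 km] AX BY]].
have := stair_X2 st km; have := @stair_Y2 _ _ _ _ _ st k.
by rewrite k1 (leqW km) => /(_ isT); case/orP: lt; lia.
Qed.

Lemma stair_h_p i : (1 <= i <= m)%N -> ~ sg (h i - p%:Z).
Proof.
case/andP=> i1 im.
have -> : h i - p%:Z = pt ((X i)%:Z + 1) (Y i)%:Z by ring.
have Y1 : (0 < Y i)%N by rewrite -(stair_Ym st) (stair_Y st).
case/(stair_sgP st) => [||k [/andP[k1 km] AX BY]]; try lia.
have ik : (i < k)%N.
  by rewrite ltnNge; apply/negP => /(stair_Xle st) /(_ (leqW im)); lia.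
by have := stair_Y st ik (leqW km); lia.
Qed.

Lemma stair_h_q i : (1 <= i <= m)%N -> ~ sg (h i - q%:Z).
Proof.
case/andP=> i1 im.
have -> : h i - q%:Z = pt (X i)%:Z ((Y i)%:Z + 1) by ring.
have X1 : (0 < X i)%N by rewrite -(stair_X0 st) (stair_X st) // leqW.
case/(stair_sgP st) => [||k [/andP[k1 km] AX BY]]; try lia.
have ki : (k < i)%N.
  by rewrite ltnNge; apply/negP => /(stair_Yle st) /(_ (leqW km)); lia.
by have := stair_X st ki (leqW im); lia.
Qed.

(** Wrapping around in Y when l < i, and in X when i < l, makes both coordinates positive; the
    wrapped one exceeds its half bound. *)
Lemma stair_h_h i l : (1 <= i <= m)%N -> (1 <= l <= m)%N -> l <> i ->
  ~ sg (h i - h l).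
Proof.
case/andP=> i1 im /andP[l1 lm] li.
have X1 : (0 < X i)%N by rewrite -(stair_X0 st) (stair_X st) // leqW.
have Y1 : (0 < Y i)%N by rewrite -(stair_Ym st) (stair_Y st).
have Xi := stair_X2 st im; have Xl := stair_X2 st lm.
have Yi := @stair_Y2 _ _ _ _ _ st i; rewrite i1 leqW // in Yi; have {}Yi := Yi isT.
have Yl := @stair_Y2 _ _ _ _ _ st l; rewrite l1 leqW // in Yl; have {}Yl := Yl isT.
have [lti|] := leqP l.+1 i.
  have Xil := stair_X st lti (leqW im).
  have -> : h i - h l = pt ((X i)%:Z - (X l)%:Z) (p%:Z - (Y l)%:Z + (Y i)%:Z) by ring.
  by apply: stair_sg_bound; lia.
move=> il'; have il : (i < l)%N by lia.
have Yil := stair_Y st il (leqW lm).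
have -> : h i - h l = pt (q%:Z - (X l)%:Z + (X i)%:Z) ((Y i)%:Z - (Y l)%:Z) by ring.
by apply: stair_sg_bound; lia.
Qed.

Lemma stair_e_pq j : (j <= m)%N -> ~ sg (e j - p%:Z - q%:Z).
Proof.
move=> jm; have := stair_corner_notin st jm.
by have -> : pt ((X j)%:Z + 1) ((Y j.+1)%:Z + 1) = e j - p%:Z - q%:Z by ring.
Qed.

Hypothesis m2 : (2 <= m)%N.

(** Strict monotonicity leaves X_m as the only abscissa that can equal q/2, and Y_1 as the only
    ordinate that can equal p/2. *)
Lemma stair_lt_q i : (1 <= i < m)%N -> (2 * X i < q)%N.
Proof.
case/andP=> i1 im; have := stair_X st im (leqnSn _).
by have := stair_X2 st (leqnn m); lia.
Qed.

Lemma stair_lt_p i : (2 <= i <= m)%N -> (2 * Y i < p)%N.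
Proof.
case/andP=> i1 im; have := stair_Y st i1 (leqW im).
by have := @stair_Y2 _ _ _ _ _ st 1 isT; lia.
Qed.

Lemma stair_e_p_h j l : (j < m)%N -> (1 <= l <= m)%N -> l <> j.+1 ->
  ~ sg (e j - p%:Z - h l).
Proof.
move=> jm /andP[l1 lm] lj.
have Y1 : (0 < Y j.+1)%N by rewrite -(stair_Ym st) (stair_Y st).
have Xl := stair_X2 st lm; have Xj := stair_X2 st (ltnW jm).
have Yl := @stair_Y2 _ _ _ _ _ st l; rewrite l1 leqW // in Yl; have {}Yl := Yl isT.
have Yj := @stair_Y2 _ _ _ _ _ st j.+1 (leqW jm).
have [lti|] := leqP l j.
  have Xil := stair_Xle st lti (leqW (ltnW jm)).
  have -> : e j - p%:Z - h l
    = pt ((X j)%:Z + 1 - (X l)%:Z) (p%:Z - (Y l)%:Z + (Y j.+1)%:Z) by ring.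
  by apply: stair_sg_bound; lia.
move=> jl; have jl' : (j.+1 < l)%N by lia.
have Yil := stair_Y st jl' (leqW lm).
have Xil := stair_X st jl (leqW lm).
have -> : e j - p%:Z - h l
  = pt (q%:Z - (X l)%:Z + (X j)%:Z + 1) ((Y j.+1)%:Z - (Y l)%:Z) by ring.
by apply: stair_sg_bound; lia.
Qed.

Lemma stair_e_h_q j : (j < m)%N -> ~ sg (e j - h j.+1 - q%:Z).
Proof.
move=> jm.
have Xj := stair_X2 st jm.
have Xjj := stair_X st (ltnSn j) (leqW jm).
have -> : e j - h j.+1 - q%:Z = pt (q%:Z - (X j.+1)%:Z + (X j)%:Z) 1 by ring.
apply: stair_sg_bound => //; first by have := stair_q st; lia.
case: j jm Xj Xjj => [|j] jm Xj Xjj.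
  by have := @stair_lt_q 1 m2; lia.
have : (0 < X j.+1)%N by rewrite -(stair_X0 st) (stair_X st) // leqW // ltnW.
by lia.
Qed.

Lemma stair_e_h_h j l : (j < m)%N -> (1 <= l <= m)%N -> l <> j.+1 ->
  ~ sg (e j - h j.+1 - h l).
Proof.
move=> jm /andP[l1 lm] lj.
have Xj := stair_X2 st jm; have Xl := stair_X2 st lm.
have Xjj := stair_X st (ltnSn j) (leqW jm).
have Yl := @stair_Y2 _ _ _ _ _ st l; rewrite l1 leqW // in Yl; have {}Yl := Yl isT.
have Y1 : (0 < Y l)%N by rewrite -(stair_Ym st) (stair_Y st).
have p0 := stair_p st.
have -> : e j - h j.+1 - h l
  = pt (q%:Z - (X l)%:Z - (X j.+1)%:Z + (X j)%:Z) (p%:Z - (Y l)%:Z) by ring.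
have lt : (X l + X j.+1 < q)%N.
  have : (X l < X j.+1 \/ X j.+1 < X l)%N.
    have [ll|ll|//] := ltngtP l j.+1.
      by left; apply: (stair_X st ll); apply: leqW.
    by right; apply: (stair_X st ll); apply: leqW.
  by lia.
have [l2|l2] := leqP l 1; last first.
  have := @stair_lt_p l; rewrite l2 lm => /(_ isT) ?.
  by apply: stair_sg_bound; lia.
(* Here Y_1 = p/2 is possible and the half bound says nothing. A covering point would have to be the
   first one, but its abscissa is too small since j >= 1. *)
have {l2} l1' : l = 1%N by lia.
subst l.
case/(stair_sgP st) => [||k [/andP[k1 km] AX BY]]; try lia.
have [k2|k2] := leqP k 1; last first.
  by have := @stair_lt_p k; rewrite k2 km; lia.
have {k2} k1' : k = 1%N by lia.
subst k.
have : (X 1 <= X j)%N by apply: (stair_Xle st); lia.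
by lia.
Qed.

Lemma stair_em_q_h l : (1 <= l < m)%N -> ~ sg (e m - q%:Z - h l).
Proof.
case/andP=> l1 lm.
rewrite (stair_Ym st).
have Yl := @stair_Y2 _ _ _ _ _ st l; rewrite l1 (leqW (ltnW lm)) in Yl; have {}Yl := Yl isT.
have Xlm := stair_X st lm (leqnSn _).
have -> : pt (X m)%:Z 0 - q%:Z - h l
  = pt ((X m)%:Z - (X l)%:Z) (p%:Z + 1 - (Y l)%:Z) by ring.
by apply: stair_sg_bound; lia.
Qed.

Lemma stair_em_h_p : ~ sg (e m - h m - p%:Z).
Proof.
rewrite (stair_Ym st).
have -> : pt (X m)%:Z 0 - h m - p%:Z = pt 1 (p%:Z - (Y m)%:Z) by ring.
have := @stair_lt_p m; rewrite m2 leqnn => /(_ isT) ?.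
by apply: stair_sg_bound; lia.
Qed.

Lemma stair_em_h_h l : (1 <= l < m)%N -> ~ sg (e m - h m - h l).
Proof.
case/andP=> l1 lm.
rewrite (stair_Ym st).
have Xl := @stair_lt_q l; rewrite l1 lm in Xl; have {}Xl := Xl isT.
have Yl := @stair_Y2 _ _ _ _ _ st l; rewrite l1 (leqW (ltnW lm)) in Yl; have {}Yl := Yl isT.
have Ym := @stair_lt_p m; rewrite m2 leqnn in Ym; have {}Ym := Ym isT.
have -> : pt (X m)%:Z 0 - h m - h l
  = pt (q%:Z - (X l)%:Z) (p%:Z - (Y l)%:Z - (Y m)%:Z) by ring.
by apply: stair_sg_bound; lia.
Qed.

End Staircase2.

Definition stairX (q m : nat) (xs : nat -> nat) (i : nat) : nat :=
  if i == 0%N then 0%N else if i == m.+1 then q else xs i.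

Definition stairY (p m : nat) (ys : nat -> nat) (i : nat) : nat :=
  if i == 0%N then p else if i == m.+1 then 0%N else ys i.

Lemma stairXE q m xs i : (1 <= i <= m)%N -> stairX q m xs i = xs i.
Proof. by rewrite /stairX => im; do 2 (case: ifP => [/eqP|_]; first lia). Qed.

Lemma stairYE p m ys i : (1 <= i <= m)%N -> stairY p m ys i = ys i.
Proof. by rewrite /stairY => im; do 2 (case: ifP => [/eqP|_]; first lia). Qed.

Lemma in_KW_staircase p q m xs ys H :
  (0 < p)%N -> (p < q)%N -> coprime p q -> in_KW p q m.+2 xs ys H ->
  staircase p q m (stairX q m xs) (stairY p m ys).
Proof.
move=> p0 pq cpq [n3 bnd mono _ _].
rewrite subn2 /= in bnd mono.
split=> //.
- by split; rewrite /stairX /stairY ?eqxx.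
- move=> i j ij jm.
  rewrite /stairX /stairY.
  have -> : (j == 0)%N = false by lia.
  have -> : (i == m.+1)%N = false by lia.
  case: ifP => [/eqP i0|/eqP i0]; case: ifP => [/eqP jm'|/eqP jm'].
  + by lia.
  + by have [] := bnd j ltac:(lia); lia.
  + by have [] := bnd i ltac:(lia); lia.
  + by apply: mono; lia.
- by move=> i im; rewrite stairXE ?stairYE //; have [] := bnd i im.
Qed.

Section KWStaircase.
Variables (p q m : nat) (xs ys : nat -> nat).
Local Notation X := (stairX q m xs).
Local Notation Y := (stairY p m ys).
Hypothesis st : staircase p q m X Y.
Local Notation sg := (stair_sg p q m X Y).
Local Notation a := (@KWgens p q m.+2 xs ys).
Local Notation h i :=
  (p%:Z * q%:Z - (X i)%:Z * p%:Z - (Y i)%:Z * q%:Z).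

Lemma KWh_stair i : (1 <= i <= m)%N -> (KWh p q xs ys i)%:Z = h i.
Proof.
move=> im; rewrite /KWh -(stairXE q xs im) -(stairYE p ys im).
have := @stair_Y2 _ _ _ _ _ st i; have := @stair_X2 _ _ _ _ _ st i.
case/andP: im => i1 im; rewrite i1 im leqW // => /(_ isT) Xi /(_ isT) Yi.
have : (X i * p + Y i * q <= p * q)%N by nia.
by nia.
Qed.

Lemma stair_sg_sum (I : finType) (f : I -> nat) :
  (forall i, sg (f i)%:Z) -> sg (\sum_i f i)%N%:Z.
Proof.
move=> sgf; apply: (big_ind (fun s : nat => sg s%:Z)) => //.
  exact: stair_sg0.
by move=> s t sgs sgt; rewrite PoszD; apply: stair_sg_add.
Qed.

Lemma stair_sg_mul s (k : nat) : sg s%:Z -> sg (k * s)%N%:Z.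
Proof.
move=> sgs; elim: k => [|k IH]; first exact: stair_sg0.
by rewrite mulSn PoszD; apply: stair_sg_add.
Qed.

Lemma monoid_gen_stair s : monoid_gen a s <-> sg s%:Z.
Proof.
have m0 := stair_m st.
split.
  case=> c ->; apply: stair_sg_sum => j; apply: stair_sg_mul.
  rewrite /KWgens; case: j => [[|[|i]] im] /=.
  - have := stair_sgD 1 0 (stair_sg0 st).
    by congr sg; rewrite /=; lia.
  - have := stair_sgD 0 1 (stair_sg0 st).
    by congr sg; rewrite /=; lia.
  - by rewrite KWh_stair //; apply: stair_sg_h.
case=> i [c [d [im E]]].
exists (fun j : 'I_m.+2 => match val j with
                 | 0 => c | 1 => d | k.+1 => (k == i) : nat end).
rewrite 2!big_ord_recl /= /KWgens /=.
case: i im E => [|i] im E.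
  rewrite big1 => [|j _]; last by rewrite /= mul0n.
  by rewrite (stair_X0 st) (stair_Y0 st) in E; lia.
rewrite (bigD1 (Ordinal im)) //= eqxx mul1n.
rewrite big1 => [|j ji]; last first.
  rewrite /= /bump /= !add1n eqSS.
  by case: eqP => [jE|]; [case/eqP: ji; apply: val_inj|rewrite mul0n].
have hE := @KWh_stair i.+1 im.
rewrite /bump /= !add1n.
by rewrite add0n; lia.
Qed.

End KWStaircase.

(** * The semigroup determines its staircase *)

Section Uniqueness.
Variables (p q m : nat).
Local Notation pt A B := (p%:Z * q%:Z - A * p%:Z - B * q%:Z).

Lemma stair_sub_corner X Y X' Y' : staircase p q m X Y -> staircase p q m X' Y' ->
  (forall s : nat, stair_sg p q m X Y s%:Z -> stair_sg p q m X' Y' s%:Z) ->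
  forall i, (1 <= i <= m)%N ->
    exists k, [/\ (1 <= k <= m)%N, (X i <= X' k)%N & (Y i <= Y' k)%N].
Proof.
move=> st st' sub i /andP[i1 im].
have Xi := stair_X2 st im.
have Yi := @stair_Y2 _ _ _ _ _ st i; rewrite i1 leqW // in Yi; have {}Yi := Yi isT.
have h0 : 0 <= pt (X i)%:Z (Y i)%:Z by nia.
have := stair_sg_h p q X Y im; rewrite -[pt _ _]gez0_abs // => /sub.
rewrite gez0_abs //.
have X1 : (0 < X i)%N by rewrite -(stair_X0 st) (stair_X st) // leqW.
have Y1 : (0 < Y i)%N by rewrite -(stair_Ym st) (stair_Y st).
by case/(stair_sgP st') => [||k [km ? ?]]; try lia; exists k; split=> //; lia.
Qed.

(** A point is below a point of the other staircase, which is below a point of the first one; a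
    staircase is an antichain, so all three agree. *)
Lemma stair_eq_corner X Y X' Y' : staircase p q m X Y -> staircase p q m X' Y' ->
  (forall s : nat, stair_sg p q m X Y s%:Z <-> stair_sg p q m X' Y' s%:Z) ->
  forall i, (1 <= i <= m)%N ->
    exists k, [/\ (1 <= k <= m)%N, (X i = X' k)%N & (Y i = Y' k)%N].
Proof.
move=> st st' eqv i im.
have [|k [km Xk Yk]] := stair_sub_corner st st' _ im; first by move=> s /eqv.
have [|l [lm Xl Yl]] := stair_sub_corner st' st _ km; first by move=> s /eqv.
suff li : l = i by exists k; split=> //; subst l; lia.
have [il|il|//] := ltngtP l i.
  by have := @stair_X _ _ _ _ _ st _ _ il; lia.
by have := @stair_Y _ _ _ _ _ st _ _ il; lia.
Qed.

Lemma stair_leX X Y X' Y' : staircase p q m X Y -> staircase p q m X' Y' ->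
  (forall s : nat, stair_sg p q m X Y s%:Z <-> stair_sg p q m X' Y' s%:Z) ->
  forall i, (i <= m)%N -> exists k, [/\ (i <= k <= m)%N & X i = X' k].
Proof.
move=> st st' eqv; elim=> [|i IH] im.
  by exists 0%N; rewrite (stair_X0 st) (stair_X0 st').
have [k [km Xk]] := IH (ltnW im).
have [k' [/andP[k1 km'] Xk' _]] := @stair_eq_corner _ _ _ _ st st' eqv i.+1 im.
exists k'; split=> //; rewrite km' andbT.
have := stair_X st (ltnSn i) (leqW im).
have [|kk] := leqP k' k; last by lia.
by move=> /(stair_Xle st') /(_ ltac:(lia)); lia.
Qed.

(** Needed because [KWD_integers] quantifies over all presentations of H. By [stair_leX] in both
    directions, X i is some X' k and X' i some X l with k, l >= i, which gives both inequalities. *)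
Lemma stair_unique X Y X' Y' : staircase p q m X Y -> staircase p q m X' Y' ->
  (forall s : nat, stair_sg p q m X Y s%:Z <-> stair_sg p q m X' Y' s%:Z) ->
  forall i, (1 <= i <= m)%N -> X i = X' i /\ Y i = Y' i.
Proof.
move=> st st' eqv i im.
have eqv' s : stair_sg p q m X' Y' s%:Z <-> stair_sg p q m X Y s%:Z.
  by split=> /eqv.
case/andP: (im) => _ im2.
have [k [/andP[ik km] Xk]] := stair_leX st st' eqv im2.
have [l [/andP[il lm] Xl]] := stair_leX st' st eqv' im2.
have XX : X i = X' i.
  by have := stair_Xle st il; have := stair_Xle st' ik; lia.
split=> //.
have [j [/andP[j1 jm] Xj Yj]] := stair_eq_corner st st' eqv im.
suff ij : i = j by rewrite Yj -ij.
have [ij|ij|//] := ltngtP i j.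
  by have := stair_X st' ij; lia.
by have := stair_X st' ij; lia.
Qed.

End Uniqueness.

(** * Corners in arithmetic progression *)

Lemma second_difference (m : nat) (u : nat -> int) :
  (forall t, (t.+2 <= m)%N -> u t + u t.+2 = 2 * u t.+1) ->
  forall t, (t <= m)%N -> u t = u 0%N + t%:Z * (u 1%N - u 0%N).
Proof.
move=> d2 t; have [n] := ubnP t; elim: n t => // n IH [|[|t]] tn tm.
- by rewrite mul0r addr0.
- by rewrite mul1r addrC subrK.
have := d2 t tm; rewrite (IH t) ?(IH t.+1); lia.
Qed.

Lemma increasing_id (m : nat) (f : nat -> nat) :
  (forall t u, (t < u)%N -> (u <= m)%N -> (f t < f u)%N) ->
  (forall t, (t <= m)%N -> (f t <= m)%N) ->
  forall t, (t <= m)%N -> f t = t.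
Proof.
move=> mono fm.
have lef t : (t <= m)%N -> (t <= f t)%N.
  elim: t => // t IH tm; have := mono t t.+1 (ltnSn t) tm.
  by have := IH (ltnW tm); lia.
have gef d : (d <= m)%N -> (f (m - d) <= m - d)%N.
  elim: d => [|d IH] dm; first by rewrite subn0 fm.
  have := mono (m - d.+1)%N (m - d)%N ltac:(lia) ltac:(lia).
  by have := IH (ltnW dm); lia.
move=> t tm; apply/eqP; rewrite eqn_leq lef // andbT.
by have := gef (m - t)%N ltac:(lia); rewrite (_ : m - (m - t) = t)%N //; lia.
Qed.

Section Arithmetic.
Variables (p q m : nat) (X Y : nat -> nat).
Hypothesis st : staircase p q m X Y.
Local Notation pt A B := (p%:Z * q%:Z - A * p%:Z - B * q%:Z).
Local Notation e j := (pt (X j)%:Z (Y j.+1)%:Z).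

(* The equation forces q to divide 2 X b - X a - X c, whose absolute value is
   less than q. *)
Lemma stair_midpoint a b c : (a <= m)%N -> (b <= m)%N -> (c <= m)%N -> a <> c ->
  e a + e c = 2 * e b ->
  (X a)%:Z + (X c)%:Z = 2 * (X b)%:Z /\
  (Y a.+1)%:Z + (Y c.+1)%:Z = 2 * (Y b.+1)%:Z.
Proof.
move=> am bm cm ac E.
have neqX : (X a < X c \/ X c < X a)%N.
  have [ac'|ac'|//] := ltngtP a c.
    by left; apply: (stair_X st) => //; apply: leqW.
  by right; apply: (stair_X st) => //; apply: leqW.
have Xa := stair_X2 st am; have Xb := stair_X2 st bm; have Xc := stair_X2 st cm.
have E' : (2 * (X b)%:Z - (X a)%:Z - (X c)%:Z) * p%:Z
  + (2 * (Y b.+1)%:Z - (Y a.+1)%:Z - (Y c.+1)%:Z) * q%:Z = 0.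
  by move/eqP: E; rewrite -subr_eq0 => /eqP E; rewrite -[RHS]E; ring.
have [|? ?] := coord_uniq (stair_cop st) (stair_q st) E'; last by split; lia.
by apply/orP; left; apply/andP; split; lia.
Qed.

Lemma stair_e_inj i j : (i <= m)%N -> (j <= m)%N -> e i = e j -> i = j.
Proof.
move=> im jm E.
have E' : ((X i)%:Z - (X j)%:Z) * p%:Z + ((Y i.+1)%:Z - (Y j.+1)%:Z) * q%:Z = 0.
  by move/eqP: E; rewrite -subr_eq0 => /eqP E; rewrite -[RHS]oppr0 -E; ring.
have Xi := stair_X2 st im; have Xj := stair_X2 st jm; have q0 := stair_q st.
have [|XX _] := coord_uniq (stair_cop st) (stair_q st) E'.
  by apply/orP; left; apply/andP; split; lia.
have [ij|ij|//] := ltngtP i j.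
  by have := stair_X st ij (leqW jm); lia.
by have := stair_X st ij (leqW im); lia.
Qed.

(** The progression may list the corners in any order f. By [stair_midpoint] the coordinates are
    affine along f, so f is monotone and hence the identity or the reversal. Thus X and Y are affine
    in the index, and X_0 = 0, Y_(m+1) = 0 fix the constants. *)
Lemma stair_arith (z k : int) : k != 0 ->
  (forall t, (t <= m)%N -> exists2 j, (j <= m)%N & e j = z + t%:Z * k) ->
  exists x y : nat, [/\ (0 < x)%N, (0 < y)%N & forall i, (1 <= i <= m)%N ->
    X i = (i * x)%N /\ Y i = ((m.+1 - i) * y)%N].
Proof.
move=> k0 AP; have m0 := stair_m st.
have /fin_all_exists [s sE] (t : 'I_m.+1) :
    exists j : 'I_m.+1, e j = z + t%:Z * k.
  have [j jm jE] := AP t (ltn_ord t).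
  by exists (Ordinal (jm : (j < m.+1)%N)).
pose f t : nat := s (inord t).
have fm t : (f t <= m)%N by rewrite -ltnS ltn_ord.
have fE t : (t <= m)%N -> e (f t) = z + t%:Z * k.
  by move=> tm; rewrite /f sE inordK.
have finj t u : (t <= m)%N -> (u <= m)%N -> t <> u -> f t <> f u.
  move=> tm um tu fe; have := fE t tm; rewrite fe fE // => /addrI /eqP.
  by rewrite -subr_eq0 -mulrBl mulf_eq0 (negbTE k0) orbF; lia.
have mid t : (t.+2 <= m)%N ->
    (X (f t))%:Z + (X (f t.+2))%:Z = 2 * (X (f t.+1))%:Z /\
    (Y (f t).+1)%:Z + (Y (f t.+2).+1)%:Z = 2 * (Y (f t.+1).+1)%:Z.
  move=> tm; apply: stair_midpoint; rewrite ?fm //.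
    by apply: finj; lia.
  rewrite !fE; lia.
have fX := @second_difference m (fun t => (X (f t))%:Z) (fun t tm => proj1 (mid t tm)).
have fY := @second_difference m (fun t => (Y (f t).+1)%:Z) (fun t tm => proj2 (mid t tm)).
rewrite /= in fX fY.
move: (X (f 0%N))%:Z ((X (f 1%N))%:Z - _) (Y (f 0%N).+1)%:Z ((Y (f 1%N).+1)%:Z - _) fX fY.
move=> x0 dx y0 dy fX fY.
have lin : exists c d c' d' : int, forall i, (i <= m)%N ->
    (X i)%:Z = c + i%:Z * d /\ (Y i.+1)%:Z = c' + i%:Z * d'.
  have Xlt i j : (i <= m)%N -> (j <= m)%N -> (X i < X j)%N -> (i < j)%N.
    move=> im jm; rewrite !ltnNge => ij; apply/negP => ji.
    by rewrite (stair_Xle st ji (leqW im)) in ij.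
  have [dx0|[dx0|dx0]] : 0 < dx \/ dx = 0 \/ dx < 0 by lia.
    have fid := @increasing_id m f _ (fun t _ => fm t).
    exists x0, dx, y0, dy => i im.
    rewrite -fX // -fY // fid // => t u tu um.
    apply: Xlt => //; have := fX u um; have := fX t (ltnW (leq_trans tu um)).
    by nia.
    have := fX 1%N m0; have := fX 0%N (leq0n _); rewrite dx0 => X0 X1.
    have [ff|ff|/esym ff] := ltngtP (f 0%N) (f 1%N).
    - by have := stair_X st ff (leqW (fm _)); lia.
    - by have := stair_X st ff (leqW (fm _)); lia.
    - by case: (finj 1%N 0%N m0 (leq0n _)).
  have fid := @increasing_id m (fun t => f (m - t)%N) _ (fun t _ => fm _).
  exists (x0 + m%:Z * dx), (- dx), (y0 + m%:Z * dy), (- dy) => i im.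
  have fi : f (m - i)%N = i.
    apply: fid => // t u tu um; apply: Xlt => //.
    have := fX (m - u)%N (leq_subr _ _); have := fX (m - t)%N (leq_subr _ _).
    by nia.
  have := fX (m - i)%N (leq_subr _ _); have := fY (m - i)%N (leq_subr _ _).
  rewrite fi => -> ->; rewrite -subzn //; split; ring.
have [c [d [c' [d' {}lin]]]] := lin.
have [X0 _] := lin 0%N (leq0n _); have [X1 Y2] := lin 1%N m0.
have [_ Y1] := lin 0%N (leq0n _); have [_ Ym] := lin m (leqnn _).
rewrite (stair_X0 st) in X0; rewrite (stair_Ym st) in Ym.
have := stair_X st (ltnSn 0%N) (ltnW m0); rewrite (stair_X0 st) => X1p.
have Yp := stair_Y st (ltnSn 1%N) m0.
exists (X 1%N), `|d'|%N; split=> //; first by lia.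
move=> i /andP[i1 im]; split.
  by have [Xi _] := lin i im; nia.
have [_] := lin i.-1 (leq_trans (leq_pred _) im); rewrite prednK //.
have -> : (i.-1)%:Z = i%:Z - 1 by lia.
have mi : (m.+1 - i)%:Z = m%:Z + 1 - i%:Z by lia.
move=> Yi; apply/eqP; rewrite -eqz_nat PoszM mi.
have -> : `|d'|%N%:Z = - d' by lia.
apply/eqP; rewrite Yi; have -> : c' = - (m%:Z * d') by lia.
by ring.
Qed.

End Arithmetic.

(** * Ideals and evaluation functionals *)

Lemma mnm_split_var n (w : 'X_{1..n}) : w != 0%MM ->
  exists i w', w = (U_(i) + w')%MM.
Proof.
move=> w0; have [i wi] : exists i, (0 < w i)%N.
  apply/existsP; apply: contraNT w0 => /existsPn w0.
  apply/eqP/mnmP => i; have := w0 i.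
  by rewrite mnm0E -eqn0Ngt => /eqP.
exists i, (w - U_(i))%MM; rewrite addmC submK //; apply/mnm_lepP => j.
by rewrite mnm1E; case: eqP => // <-.
Qed.

Section Evaluation.
Variables (K : fieldType) (n : nat) (a : 'I_n -> nat).
Implicit Types (J : pred 'I_n) (w : 'X_{1..n}) (f g : {mpoly K[n]}).

(** The monomial curve restricted to the coordinate subspace of J. For [predT] all monomials of one
    degree have the same image; a smaller J tells them apart. *)
Definition evJ J : {mpoly K[n]} -> {poly K} :=
  mmap (@polyC K) (fun i => if J i then 'X^(a i) else 0).

Definition supp_in J w : bool := [forall i, (0 < w i)%N ==> J i].

Lemma evJ_X J w : evJ J 'X_[w] = if supp_in J w then 'X^(wdeg a w) else 0.
Proof.
rewrite /evJ mmapX /mmap1.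
case: ifPn => [/forallP sw|/forallPn [i]].
  rewrite /wdeg -GRing.prodrXr; apply: eq_bigr => i _.
  have := sw i; case: posnP => [->|_ /= ->]; first by rewrite expr0 mul0n expr0.
  by rewrite mulnC exprM.
rewrite negb_imply => /andP[wi /negbTE Ji].
by rewrite (bigD1 i) //= Ji expr0n eqn0Ngt wi mul0r.
Qed.

Lemma evJ_coef J f d :
  (evJ J f)`_d = \sum_(w <- msupp f) f@_w * (supp_in J w && (wdeg a w == d))%:R.
Proof.
rewrite {1}[f]mpolyE /evJ raddf_sum /= coef_sum; apply: eq_bigr => w _.
rewrite mmapZ -/(evJ _ _) evJ_X coefCM; congr (_ * _).
by case: ifP => _; rewrite ?coef0 // coefXn eq_sym.
Qed.

Lemma evJM J : {morph evJ J : f g / f * g}.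
Proof. by move=> f g; rewrite /evJ rmorphM. Qed.
Lemma evJB J : {morph evJ J : f g / f - g}.
Proof. by move=> f g; rewrite /evJ rmorphB. Qed.
Lemma evJD J : {morph evJ J : f g / f + g}.
Proof. by move=> f g; rewrite /evJ rmorphD. Qed.
Lemma evJ_sum J (I : Type) (r : seq I) (F : I -> {mpoly K[n]}) :
  evJ J (\sum_(i <- r) F i) = \sum_(i <- r) evJ J (F i).
Proof. by rewrite /evJ rmorph_sum. Qed.

Lemma in_defining_ideal f : defining_ideal a f <-> evJ predT f = 0.
Proof. by []. Qed.

(* No monomial of degree d involves variables from both J and its complement. *)
Definition splits d J : Prop :=
  forall w, wdeg a w = d -> supp_in J w \/ supp_in (predC J) w.

Lemma wdegU i : wdeg a U_(i)%MM = a i.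
Proof.
rewrite /wdeg (bigD1 i) //= mnm1E eqxx mul1n big1 ?addn0 // => j ji.
by rewrite mnm1E eq_sym (negbTE ji).
Qed.

(** For i in J every monomial of degree d divisible by X_i has its support in J, so restriction to J
    does not change the coefficient, which is 0 for the full parametrisation. *)
Lemma splits_mulX d J i f : splits d J -> defining_ideal a f ->
  (evJ J ('X_i * f))`_d = 0.
Proof.
move=> sp If; rewrite evJM evJ_X.
case: ifP => [sJ|_]; last by rewrite mul0r coef0.
have Ji : J i by move/forallP: sJ => /(_ i); rewrite mnm1E eqxx.
rewrite wdegU coefXnM; case: ltnP => // led.
suff -> : (evJ J f)`_(d - a i) = (evJ predT f)`_(d - a i).
  by rewrite (_ : evJ predT f = 0) // coef0.
rewrite !evJ_coef; apply: eq_bigr => w _; congr (_ * _%:R).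
case: eqP => [wd|]; last by rewrite !andbF.
rewrite !andbT; have wid : wdeg a (U_(i) + w)%MM = d.
  by rewrite wdegD wdegU wd subnKC.
have -> : supp_in predT w by apply/forallP => j; rewrite implybT.
suff -> : supp_in J w by [].
case: (sp _ wid) => /forallP sw; apply/forallP => j; have := sw j.
  by rewrite mnmDE; case: (posnP (w j)) => // wj; rewrite addn_gt0 wj orbT.
by have := sw i; rewrite mnmDE mnm1E eqxx /= Ji.
Qed.

(* Hence f |-> (evJ J f)`_d vanishes on the product of the defining ideal and
   the irrelevant ideal. *)
Lemma splits_mul d J c f : splits d J -> defining_ideal a f ->
  (evJ J (c * f))`_d = c@_0%MM * (evJ J f)`_d.
Proof.
move=> sp If; elim/mpolyind: c => [|c w p _ _ IH].
  by rewrite mul0r /evJ raddf0 coef0 mcoeff0 mul0r.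
rewrite mulrDl evJD coefD IH mcoeffD mulrDl; congr (_ + _).
rewrite mcoeffZ mcoeffX -scalerAl /evJ mmapZ -/(evJ _ _) coefCM -mulrA.
congr (_ * _); have [->|w0] := eqVneq w 0%MM; first by rewrite mpolyX0 !mul1r.
rewrite mul0r.
have [i [w' ->]] := mnm_split_var w0.
rewrite mpolyXD -mulrA; apply: splits_mulX => //.
by rewrite /defining_ideal rmorphM /= (_ : mmap _ _ f = 0) ?mulr0.
Qed.

Lemma evJ_homog J f d : f \is ishomog1 d (wdeg a) ->
  evJ J f = (evJ J f)`_d *: 'X^d.
Proof.
move=> /allP hf; apply/polyP => e; rewrite coefZ coefXn.
have [->|ed] := eqVneq e d; first by rewrite mulr1.
rewrite mulr0 evJ_coef big_seq big1 // => w /hf /= /eqP wd.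
by rewrite wd eq_sym (negbTE ed) andbF mulr0.
Qed.

(** A nonzero value on the axis of X_i exhibits a pure power of X_i in f, and the vanishing constant
    term makes its exponent positive. *)
Lemma evJ_single i f d : f \is ishomog1 d (wdeg a) -> f@_0%MM = 0 ->
  evJ (pred1 i) f != 0 -> exists2 s, (0 < s)%N & d = (s * a i)%N.
Proof.
move=> hf f0 ev0.
have : (evJ (pred1 i) f)`_d != 0.
  by apply: contraNneq ev0 => ev0; rewrite (evJ_homog _ hf) ev0 scale0r.
rewrite evJ_coef big_seq => S0.
have [w wf /andP[sw /eqP wd]] :
    exists2 w, w \in msupp f & supp_in (pred1 i) w && (wdeg a w == d).
  apply/hasP; apply: contraNT S0 => /hasPn no.
  rewrite big1 // => w wf; rewrite (negbTE (no w wf)) mulr0 //.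
have wdE : wdeg a w = (w i * a i)%N.
  rewrite /wdeg (bigD1 i) //= big1 ?addn0 // => j ji.
  move/forallP: sw => /(_ j) /=; rewrite (negbTE ji) implybF.
  by rewrite -eqn0Ngt => /eqP ->.
exists (w i); last by rewrite -wd wdE.
rewrite lt0n; apply/eqP => wi; move: wf; rewrite mcoeff_msupp.
suff -> : w = 0%MM by rewrite f0 eqxx.
apply/mnmP => j; rewrite mnm0E; have [->//|ji] := eqVneq j i.
move/forallP: sw => /(_ j) /=; rewrite (negbTE ji) implybF.
by rewrite -eqn0Ngt => /eqP ->.
Qed.

Lemma irrelevant_coef0 f : irrelevant_ideal f -> f@_0%MM = 0.
Proof.
case=> k [c [g [gX ->]]]; rewrite raddf_sum /= big1 // => i _.
case: (gX i) => j ->; rewrite rmorphM /= mcoeffX mnm1_eq0 mulr0 //.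
Qed.

End Evaluation.

Section Ideal.
Variables (R : comNzRingType) (S : R -> Prop).

Lemma ideal_gen0 : ideal_gen S 0.
Proof.
by exists 0%N, (fun=> 0), (fun=> 0); split=> [[]|]; rewrite ?big_ord0.
Qed.

Lemma ideal_gen_base f : S f -> ideal_gen S f.
Proof.
by move=> Sf; exists 1%N, (fun=> 1), (fun=> f); rewrite big_ord1 mul1r.
Qed.

Lemma ideal_genM c f : ideal_gen S f -> ideal_gen S (c * f).
Proof.
case=> k [d [g [Sg ->]]]; exists k, (fun i => c * d i), g; split=> //.
by rewrite mulr_sumr; apply: eq_bigr => i _; rewrite mulrA.
Qed.

Lemma ideal_genD f g : ideal_gen S f -> ideal_gen S g -> ideal_gen S (f + g).
Proof.
case=> k [c [u [Su ->]]] [l [d [v [Sv ->]]]].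
exists (k + l)%N.
exists (fun i => match split i with inl j => c j | inr j => d j end).
exists (fun i => match split i with inl j => u j | inr j => v j end).
split; first by move=> i; case: (split i).
rewrite big_split_ord /=; congr (_ + _); apply: eq_bigr => i _.
  by rewrite (unsplitK (inl i)).
by rewrite (unsplitK (inr i)).
Qed.

Lemma ideal_genN f : ideal_gen S f -> ideal_gen S (- f).
Proof. by rewrite -mulN1r; apply: ideal_genM. Qed.

Lemma ideal_gen_min (I : R -> Prop) :
  I 0 -> (forall f g, I f -> I g -> I (f + g)) -> (forall c f, I f -> I (c * f)) ->
  (forall f, S f -> I f) -> forall f, ideal_gen S f -> I f.
Proof.
move=> I0 ID IM SI f [k [c [g [Sg ->]]]].
by apply: big_ind => // i _; apply/IM/SI.
Qed.

Lemma ideal_gen_fintype (P : finType) (b : P -> R) f :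
  (forall g, S g -> exists k, g = b k) -> ideal_gen S f ->
  exists c : P -> R, f = \sum_k c k * b k.
Proof.
move=> Sb [k [c [g [Sg ->]]]].
have /fin_all_exists [t tE] (i : 'I_k) : exists t, g i = b t by apply: Sb.
exists (fun l => \sum_(i | t i == l) c i).
rewrite (partition_big t predT) //=; apply: eq_bigr => l _.
by rewrite mulr_suml; apply: eq_bigr => i /eqP <-; rewrite tE.
Qed.

End Ideal.

Lemma minor2E (R : comNzRingType) n (F G : 'I_n -> R) f :
  minor2 (two_rows F G) f <->
  exists i j : 'I_n, (i < j)%N /\ f = F i * G j - F j * G i.
Proof.
have dE (i j : 'I_n) :
  \det (colsub (fun k : 'I_2 => if k == ord0 then i else j) (two_rows F G))
    = F i * G j - F j * G i.
  rewrite (expand_det_row _ ord0) !big_ord_recl big_ord0 /cofactor !det_mx11.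
  by rewrite !mxE /= expr0 expr1 addr0 mul1r mulN1r mulrN.
by split=> -[i [j [ij ->]]]; exists i, j; rewrite dE.
Qed.

Lemma det_neq0_perm (R : comNzRingType) N (A : 'M[R]_N) : \det A != 0 ->
  exists s : 'S_N, forall i, A i (s i) != 0.
Proof.
move=> dA; have [s sA] : exists s : 'S_N, [forall i, A i (s i) != 0].
  apply/existsP; apply: contraNT dA => /existsPn no.
  rewrite /determinant big1 // => s _.
  have /forallPn [i /negPn/eqP Ai] := no s.
  by rewrite (bigD1 i) //= Ai mul0r mulr0.
by exists s => i; apply: (forallP sA).
Qed.

(** A left inverse makes the determinant of A nonzero, and a nonzero term of its expansion is the
    permutation. *)
Lemma left_inverse_perm (R : comUnitRingType) (P : finType) (C A : P -> P -> R) :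
  (forall k l, \sum_r C k r * A r l = (k == l)%:R) ->
  exists s : P -> P, injective s /\ forall r, A r (s r) != 0.
Proof.
move=> CA.
pose MC : 'M[R]_#|P| := \matrix_(i, j) C (enum_val i) (enum_val j).
pose MA : 'M[R]_#|P| := \matrix_(i, j) A (enum_val i) (enum_val j).
have MCA : MC *m MA = 1%:M.
  apply/matrixP => i j; rewrite !mxE -(inj_eq enum_val_inj) -CA.
  rewrite [RHS](reindex (@enum_val P predT)) /=; last first.
    by exists enum_rank => k _; rewrite ?enum_valK ?enum_rankK.
  by apply: eq_bigr => k _; rewrite !mxE.
have dA : \det MA != 0.
  apply: contra_eq_neq (congr1 determinant MCA) => dA.
  by rewrite det_mulmx dA mulr0 det1 eq_sym oner_eq0.
have [s sA] := det_neq0_perm dA.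
exists (fun r => enum_val (s (enum_rank r))); split.
  by move=> r r' /enum_val_inj/perm_inj/enum_rank_inj.
by move=> r; have := sA (enum_rank r); rewrite mxE enum_rankK.
Qed.

(* The functionals dual to the b k show that the b k are linearly independent
   modulo the irrelevant ideal times I; a generating family of the same size is
   then a basis of this quotient, and the matrix of the functionals on it is
   invertible. *)
Lemma generators_matching (K : fieldType) n (a : 'I_n -> nat) (P : finType)
    (M b : P -> {mpoly K[n]}) (d : P -> nat) (J : P -> pred 'I_n) :
  (forall k, splits a (d k) (J k)) ->
  (forall k, defining_ideal a (M k)) ->
  (forall k l, (evJ a (J l) (b k))`_(d l) = (k == l)%:R) ->
  (forall k, exists c : P -> {mpoly K[n]}, b k = \sum_r c r * M r) ->
  exists s : P -> P, injective s /\
    forall r, (evJ a (J (s r)) (M r))`_(d (s r)) != 0.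
Proof.
move=> sp MI dual /fin_all_exists [c cE].
apply: (@left_inverse_perm _ _ (fun k r => (c k r)@_0%MM)
  (fun r l => (evJ a (J l) (M r))`_(d l))) => k l.
rewrite -dual cE evJ_sum coef_sum; apply: eq_bigr => r _.
by rewrite splits_mul.
Qed.

(** * Degrees of the minors *)

Section DoubleSums.
Variables (R : comNzRingType).

Lemma sum_lt_symm N (t : 'I_N -> 'I_N -> R) : (forall i j, t i j = t j i) ->
  2 * \sum_(i < N) \sum_(j < N | (i < j)%N) t i j = \sum_i \sum_j t i j - \sum_i t i i.
Proof.
move=> sym.
have swap : \sum_(i < N) \sum_(j < N | (i < j)%N) t i j = \sum_(i < N) \sum_(j < N | (j < i)%N) t i j.
  rewrite (exchange_big_dep predT) //=.
  by apply: eq_bigr => i _; apply: eq_bigr => j _; rewrite sym.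
have split i : \sum_j t i j = \sum_(j < N | (i < j)%N) t i j + t i i
    + \sum_(j < N | (j < i)%N) t i j.
  rewrite (bigID (fun j : 'I_N => (i < j)%N)) /= -addrA; congr (_ + _).
  rewrite (bigD1 i) ?ltnn //=; congr (_ + _); apply: eq_bigl => j.
  by rewrite -leqNgt ltn_neqAle andbC.
rewrite (eq_bigr _ (fun i _ => split i)) !big_split /= -swap.
ring.
Qed.

Lemma sum_le_symm N (t : 'I_N -> 'I_N -> R) : (forall i j, t i j = t j i) ->
  2 * \sum_(i < N) \sum_(j < N | (i <= j)%N) t i j = \sum_i \sum_j t i j + \sum_i t i i.
Proof.
move=> sym.
have E : \sum_(i < N) \sum_(j < N | (i <= j)%N) t i j
    = \sum_i t i i + \sum_(i < N) \sum_(j < N | (i < j)%N) t i j.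
  rewrite -big_split; apply: eq_bigr => i _ /=.
  rewrite (bigD1 i) //=; congr (_ + _); apply: eq_bigl => j.
  by rewrite andbC eq_sym ltn_neqAle.
by rewrite E mulrDr sum_lt_symm //; ring.
Qed.

Lemma sum_injection m N (k : 'I_m -> 'I_N) : injective k -> N = m.+2 ->
  exists c1 c2 : 'I_N, forall t : 'I_N -> R,
    \sum_i t i = \sum_a t (k a) + (t c1 + t c2).
Proof.
move=> kI NE; pose S := [set k a | a in 'I_m].
have /eqP : #|~: S| = 2.
  by have := cardsC S; rewrite card_imset // !card_ord; lia.
move/cards2P => [c1 [c2 [c12 SE]]]; exists c1, c2 => t.
rewrite (bigID (mem S)) /=; congr (_ + _).
  by rewrite big_imset //= => a b _ _; apply: kI.
rewrite (eq_bigl (mem (c1 |: [set c2]))) => [|i]; last by rewrite -SE !inE.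
by rewrite big_setU1 ?inE //= big_set1.
Qed.

End DoubleSums.

(** Descending by delta from any value must stop at E0, so with E0 + t delta all smaller terms
    occur. There are only m + 1 values, hence t <= m, and by counting every t <= m is reached. *)
Lemma descending_chain m (e : 'I_m.+1 -> nat) (E0 delta : nat) :
  injective e -> (0 < delta)%N ->
  (forall j, e j <> E0 -> exists j', e j = e j' + delta)%N ->
  forall t, (t <= m)%N -> exists j, e j = (E0 + t * delta)%N.
Proof.
move=> eI d0 desc.
have down j : exists2 t, e j = (E0 + t * delta)%N &
    forall s, (s <= t)%N -> exists j', e j' = (E0 + s * delta)%N.
  have [n] := ubnP (e j); elim: n j => // n IH j jn.
  have [jE|/eqP jE] := eqVneq (e j) E0.
    by exists 0%N => [|[|s] //= _]; [lia|exists j; lia].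
  have [j' jj'] := desc j jE.
  have [|t tE down] := IH j'; first by lia.
  exists t.+1; first by rewrite jj' tE mulSn; lia.
  move=> s; rewrite leq_eqVlt => /orP[/eqP->|/down //].
  by exists j; rewrite jj' tE mulSn; lia.
pose r := [seq (E0 + s * delta)%N | s <- iota 0 m.+1].
have affI : injective (fun s => E0 + s * delta)%N.
  by move=> s s' /addnI/eqP; rewrite eqn_pmul2r // => /eqP.
have Ur : uniq r by rewrite map_inj_uniq ?iota_uniq.
have Ue : uniq (codom e) by rewrite codomE map_inj_uniq ?enum_uniq.
have sub : {subset codom e <= r}.
  move=> x /codomP [j ->]; have [t tE dj] := down j.
  rewrite tE; apply/mapP; exists t => //; rewrite mem_iota add0n /=.
  have : {subset [seq (E0 + s * delta)%N | s <- iota 0 t.+1] <= codom e}.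
    move=> y /mapP [s]; rewrite mem_iota add0n /= => st ->.
    by have [j' <-] := dj s st; apply: codom_f.
  move/uniq_leq_size; rewrite map_inj_uniq ?iota_uniq // => /(_ isT).
  by rewrite size_map size_iota size_codom card_ord.
have [|_ eqr] := uniq_min_size Ue sub.
  by rewrite size_map size_iota size_codom card_ord.
move=> t tm; have : (E0 + t * delta)%N \in codom e.
  by rewrite eqr; apply/mapP; exists t => //; rewrite mem_iota.
by case/codomP => j ->; exists j.
Qed.

Lemma coef_sum_Xn (I : finType) (e : I -> nat) d :
  (\sum_j 'X^(e j) : {poly int})`_d = (\sum_j (e j == d) : nat)%:Z.
Proof.
rewrite coef_sum -natz natr_sum; apply: eq_bigr => j _.
by rewrite coefXn eq_sym; case: eqP.
Qed.

Lemma poly_int_double_inj (x y : {poly int}) : 2 * x = 2 * y -> x = y.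
Proof.
move=> E; apply: (mulfI _ E).
by rewrite -polyC_natr polyC_eq0.
Qed.

Section Degrees.
Variables (m delta : nat) (g : 'I_m.+2 -> nat) (h : 'I_m -> nat)
  (e : 'I_m.+1 -> nat).
Local Notation Xn d := ('X^d : {poly int}).

Hypothesis eI : injective e.
Hypothesis hI : injective h.
(* Equality of the multisets {g i + g j + delta | i < j} and
   {e j} + {h a + h b | a <= b}. *)
Hypothesis multi : \sum_(i < m.+2) \sum_(j : 'I_m.+2 | (i < j)%N) Xn (g i + g j + delta)
  = \sum_j Xn (e j) + \sum_(a < m) \sum_(b : 'I_m | (a <= b)%N) Xn (h a + h b).

(** The sums over i < j and a <= b are the elementary and the complete symmetric polynomials of
    degree 2, whose doubles are p_1^2 - p_2 and p_1^2 + p_2 in the power sums. *)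
Lemma multi_double : 2 * \sum_j Xn (e j)
  = Xn delta * ((\sum_i Xn (g i)) ^+ 2 - \sum_i Xn (g i) ^+ 2)
    - (\sum_a Xn (h a)) ^+ 2 - \sum_a Xn (h a) ^+ 2.
Proof.
have sq (I : finType) (f : I -> {poly int}) :
    (\sum_i f i) ^+ 2 = \sum_i \sum_j f i * f j.
  by rewrite expr2 mulr_suml; apply: eq_bigr => i _; rewrite mulr_sumr.
have -> : \sum_j Xn (e j)
  = \sum_(i < m.+2) \sum_(j : 'I_m.+2 | (i < j)%N) Xn (g i + g j + delta)
    - \sum_(a < m) \sum_(b : 'I_m | (a <= b)%N) Xn (h a + h b).
  by rewrite multi addrK.
rewrite mulrBr sum_lt_symm => [|i j]; last by rewrite (addnC (g i)).
rewrite sum_le_symm => [|i j]; last by rewrite addnC.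
rewrite !sq mulrBr opprD !addrA; congr (_ - _ - _ - _).
- rewrite mulr_sumr; apply: eq_bigr => i _; rewrite mulr_sumr.
  by apply: eq_bigr => j _; rewrite !exprD; ring.
- by rewrite mulr_sumr; apply: eq_bigr => i _; rewrite !exprD expr2; ring.
- by apply: eq_bigr => i _; apply: eq_bigr => j _; rewrite exprD.
- by apply: eq_bigr => i _; rewrite exprD.
Qed.

Variables j k : 'I_m -> 'I_m.+2.
Hypothesis gj : forall a, (g (j a) + delta)%N = h a.
Hypothesis gk : forall a, g (k a) = h a.

Let jI : injective j.
Proof. by move=> a b ab; apply: hI; rewrite -!gj ab. Qed.

Let kI : injective k.
Proof. by move=> a b ab; apply: hI; rewrite -!gk ab. Qed.

(** The exponents g are the h and two more, c; the exponents g + delta are the h and two more, d.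
    Each description expresses the power sums of its extra pair by those of g and h, hence also the
    product of that pair. In the difference of the products everything cancels except z^delta - 1
    times [multi_double]. *)
Lemma degrees_telescope : exists s t : nat,
  (Xn delta - 1) * \sum_j Xn (e j) = Xn t - Xn s.
Proof.
have [c1 [c2 cE]] := @sum_injection [the comNzRingType of {poly int}] _ _ k kI erefl.
have [d1 [d2 dE]] := @sum_injection [the comNzRingType of {poly int}] _ _ j jI erefl.
exists (delta + (g c1 + g c2))%N.
exists ((delta + g d1) + (delta + g d2))%N.
have kE (f : {poly int} -> {poly int}) :
    \sum_a f (Xn (g (k a))) = \sum_a f (Xn (h a)).
  by apply: eq_bigr => a _; rewrite gk.
have G1 : \sum_i Xn (g i) = \sum_a Xn (h a) + (Xn (g c1) + Xn (g c2)).
  by rewrite cE (kE id).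
have G2 : \sum_i Xn (g i) ^+ 2
    = \sum_a Xn (h a) ^+ 2 + (Xn (g c1) ^+ 2 + Xn (g c2) ^+ 2).
  by rewrite (cE (fun i => _ ^+ 2)) (kE (fun x => x ^+ 2)).
have jE : \sum_a Xn delta * Xn (g (j a)) = \sum_a Xn (h a).
  by apply: eq_bigr => a _; rewrite -gj addnC exprD.
have jE2 : \sum_a (Xn delta * Xn (g (j a))) ^+ 2 = \sum_a Xn (h a) ^+ 2.
  by apply: eq_bigr => a _; rewrite -gj addnC exprD.
have D1 : Xn delta * \sum_i Xn (g i)
    = \sum_a Xn (h a) + (Xn delta * Xn (g d1) + Xn delta * Xn (g d2)).
  by rewrite mulr_sumr (dE (fun i => Xn delta * _)) jE.
have D2 : Xn delta ^+ 2 * \sum_i Xn (g i) ^+ 2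
    = \sum_a Xn (h a) ^+ 2
      + ((Xn delta * Xn (g d1)) ^+ 2 + (Xn delta * Xn (g d2)) ^+ 2).
  rewrite mulr_sumr (eq_bigr (fun i => (Xn delta * Xn (g i)) ^+ 2)) => [|i _].
    by rewrite (dE (fun i => (Xn delta * _) ^+ 2)) jE2.
  by rewrite exprMn.
apply: poly_int_double_inj.
have -> : 2 * ((Xn delta - 1) * \sum_j Xn (e j))
    = (Xn delta - 1) * (2 * \sum_j Xn (e j)) by ring.
rewrite multi_double !(exprD 'X).
move: G1 G2 D1 D2.
move: (\sum_i Xn (g i)) (\sum_i Xn (g i) ^+ 2) (\sum_a Xn (h a))
  (\sum_a Xn (h a) ^+ 2) (Xn (g c1)) (Xn (g c2)) (Xn (g d1)) (Xn (g d2)) (Xn delta).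
move=> G G2 h1 h2 x1 x2 y1 y2 z EG EG2 ED ED2.
have -> : 2 * (z * y1 * (z * y2) - z * (x1 * x2))
  = (z * y1 + z * y2) ^+ 2 - ((z * y1) ^+ 2 + (z * y2) ^+ 2)
    - z * ((x1 + x2) ^+ 2 - (x1 ^+ 2 + x2 ^+ 2)) by ring.
have -> : z * y1 + z * y2 = z * G - h1 by rewrite ED; ring.
have -> : (z * y1) ^+ 2 + (z * y2) ^+ 2 = z ^+ 2 * G2 - h2 by rewrite ED2; ring.
have -> : x1 + x2 = G - h1 by rewrite EG; ring.
have -> : x1 ^+ 2 + x2 ^+ 2 = G2 - h2 by rewrite EG2; ring.
by ring.
Qed.

(** At degree e_i <> s the right side of the telescoped identity has a nonnegative coefficient,
    while -1 times the sum contributes a negative one; some e_j = e_i - delta must compensate. *)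
Lemma degrees_arith : (0 < delta)%N ->
  exists s : nat, forall t, (t <= m)%N -> exists j, e j = (s + t * delta)%N.
Proof.
move=> d0; have [s [t E]] := degrees_telescope.
exists s; apply: descending_chain => // i eis.
have := congr1 (fun u : {poly int} => u`_(e i)) E.
rewrite mulrBl mul1r !coefB coefXnM !coefXn !coef_sum_Xn !natz.
have S0 : (0 < \sum_j0 (e j0 == e i))%N by rewrite (bigD1 i) //= eqxx.
have -> : (e i == s) = false by apply/eqP.
case: ltnP => [_|le]; first by case: (_ == t); lia.
case: (pickP (fun j => e j == e i - delta)%N) => [i' /eqP Ei' _|no].
  by exists i'; rewrite Ei' subnK.
rewrite [X in X%:Z - _]big1 => [|i' _]; last by rewrite no.
by case: (_ == t); lia.
Qed.

(** If delta = 0, each h occurs twice among the m + 2 values g, so m = 2 and g consists of h_a, h_a,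
    h_b, h_b. The sum h_a + h_b then occurs four times on the left and once among the h pairs, so
    all three e_j equal it, against injectivity. *)
Lemma degrees_delta : (2 <= m)%N -> (forall a, j a <> k a) -> (0 < delta)%N.
Proof.
move=> m2 jk; rewrite lt0n; apply/eqP => d0.
pose F (x : 'I_m + 'I_m) := match x with inl a => j a | inr a => k a end.
have FI : injective F.
  move=> [a|a] [b|b] /= E; try by [rewrite (jI E)|rewrite (kI E)].
    case: (jk a); rewrite E; congr k; apply: hI; rewrite -gk -E -(gj a) d0.
    by rewrite addn0.
  case: (jk b); rewrite -E; congr k; apply: hI; rewrite -gk E -(gj b) d0.
  by rewrite addn0.
have := leq_card _ FI; rewrite card_sum !card_ord => mm.
have {mm} mE : m = 2 by lia.
have Fb : bijective F.
  by apply: inj_card_bij FI _; rewrite card_sum !card_ord; lia.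
have sumF (t : nat -> {poly int}) : \sum_i t (g i) = 2 * \sum_a t (h a).
  rewrite (reindex F) /=; last by apply: onW_bij.
  rewrite big_sumType /= mulr2n mulrDl mul1r; congr (_ + _); apply: eq_bigr => a _.
    by rewrite -gj d0 addn0.
  by rewrite gk.
have E := multi_double.
rewrite d0 expr0 mul1r (sumF (fun n => Xn n)) (sumF (fun n => Xn n ^+ 2)) in E.
have [a [b ab]] : exists a b : 'I_m, forall t : 'I_m -> {poly int}, \sum_i t i = t a + t b.
  rewrite mE; exists ord0, ord_max => t; rewrite big_ord_recl big_ord1.
  by congr (_ + t _); apply: val_inj.
have {}E : \sum_j Xn (e j) = 3 * Xn (h a + h b).
  by apply: poly_int_double_inj; rewrite E !ab exprD; ring.
have eE i : e i = (h a + h b)%N.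
  have := congr1 (fun u : {poly int} => u`_(e i)) E.
  rewrite coef_sum_Xn -polyC_natr coefCM coefXn !natz.
  have : (0 < \sum_j0 (e j0 == e i))%N by rewrite (bigD1 i) //= eqxx.
  by case: eqP => // _; lia.
by have /eI := etrans (eE ord0) (esym (eE ord_max)); move/(congr1 val) => /=; lia.
Qed.

End Degrees.

(** * Minimal generators of the defining ideal *)

Section SuppIn.
Variables (n : nat).
Implicit Types (J : pred 'I_n) (w : 'X_{1..n}).

Lemma supp_inD J w w' : supp_in J (w + w')%MM = supp_in J w && supp_in J w'.
Proof.
apply/forallP/andP => [sJ|[/forallP sw /forallP sw'] i].
  by split; apply/forallP => i; have := sJ i; rewrite mnmDE addn_gt0;
    case: (J i); rewrite ?implybT // !implybF negb_or => /andP[].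
by have := sw i; have := sw' i; rewrite mnmDE addn_gt0; case: (J i);
  rewrite ?implybT // !implybF negb_or => -> ->.
Qed.

Lemma supp_in_Un J i k : supp_in J (U_(i) *+ k)%MM = (k == 0%N) || J i.
Proof.
apply/forallP/orP => [/(_ i)|H j].
  by rewrite mulmnE mnm1E eqxx mul1n lt0n; case: (k == 0%N) => /=; [left|right].
rewrite mulmnE mnm1E; case: eqP => [<-|_]; last by rewrite mul0n.
by rewrite mul1n lt0n; case: H => ->; rewrite ?implybT.
Qed.

Lemma supp_in_U J i : supp_in J U_(i)%MM = J i.
Proof. by rewrite -[U_(i)%MM]mulm1n supp_in_Un. Qed.

Lemma wdegUn (a : 'I_n -> nat) i k : wdeg a (U_(i) *+ k)%MM = (k * a i)%N.
Proof.
elim: k => [|k IH]; first by rewrite mulm0n wdeg0.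
by rewrite mulmS wdegD IH wdegU mulSn.
Qed.

Lemma evJ_eq (K : fieldType) (a : 'I_n -> nat) J J' (f : {mpoly K[n]}) :
  J =1 J' -> evJ a J f = evJ a J' f.
Proof.
move=> JJ; apply/polyP => d; rewrite !evJ_coef; apply: eq_bigr => w _.
congr (_ * (_ && _)%:R); apply: eq_forallb => i; by rewrite JJ.
Qed.

Lemma evJ_binomial (K : fieldType) (a : 'I_n -> nat) J w w' d :
  wdeg a w = wdeg a w' ->
  (evJ a J ('X_[w] - 'X_[w'] : {mpoly K[n]}))`_d
    = ((wdeg a w == d) && supp_in J w)%:R - ((wdeg a w == d) && supp_in J w')%:R.
Proof.
move=> ww; rewrite evJB coefB !evJ_X -ww eq_sym.
by case: ifP; case: ifP => _ _; rewrite ?coef0 ?coefXn ?andbT ?andbF.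
Qed.

End SuppIn.

Lemma wdeg_monoid_gen n (a : 'I_n -> nat) (w : 'X_{1..n}) :
  monoid_gen a (wdeg a w).
Proof. by exists (fun i => w i). Qed.

Lemma splits_criterion n (a : 'I_n -> nat) d (J : pred 'I_n) :
  (forall i i' s, J i -> ~~ J i' -> monoid_gen a s ->
     d <> (a i + a i' + s)%N) -> splits a d J.
Proof.
move=> crit w wd.
have [sJ|/forallPn [i']] := boolP (supp_in J w); first by left.
rewrite negb_imply => /andP[wi' Ji'].
have [sJ|/forallPn [i]] := boolP (supp_in (predC J) w); first by right.
rewrite negb_imply /= negbK => /andP[wi Ji].
have ii' : i != i' by apply: contraNneq Ji' => <-.
case: (crit i i' (wdeg a (w - (U_(i) + U_(i')))%MM)) => //.
  exact: wdeg_monoid_gen.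
rewrite -!wdegU -!wdegD -wd; congr wdeg.
rewrite addmC submK //; apply/mnm_lepP => j.
rewrite mnmDE !mnm1E; case: eqP => [ij|_]; case: eqP => [ij'|_] //.
- by rewrite ij ij' eqxx in ii'.
- by rewrite -ij.
- by rewrite -ij'.
Qed.

Section KWGenerators.
Variables (K : fieldType) (p q m : nat) (xs ys : nat -> nat).
Local Notation X := (stairX q m xs).
Local Notation Y := (stairY p m ys).
Hypothesis st : staircase p q m X Y.
Hypothesis m2 : (2 <= m)%N.
Local Notation sg := (stair_sg p q m X Y).
Local Notation a := (@KWgens p q m.+2 xs ys).
Local Notation pt A B := (p%:Z * q%:Z - A * p%:Z - B * q%:Z).
Local Notation h i := (pt (X i)%:Z (Y i)%:Z).
Local Notation e j := (pt (X j)%:Z (Y j.+1)%:Z).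
Local Notation V k := (inord k : 'I_m.+2).
Local Notation hn := (KWh p q xs ys).

(* The degree of the relation
   u^(X (j+1) - X j) u_(j+1) = v^(Y j - Y (j+1)) u_j, with u_0 = u_(m+1) = 1;
   the pseudo-Frobenius numbers are these degrees minus p + q. *)
Definition corner (j : nat) : nat := `|e j|%N.
Local Notation en := corner.

(* The C(n,2) minimal generators of the defining ideal are indexed by the pairs
   i < j of 'I_n: the pair (0, j) stands for the relation of degree corner (j-1)
   and the pair (i, j) with 0 < i for u_i u_(j-1) - u^_ v^_. The generator is
   'X_[gen_lhs i j] - 'X_[gen_rhs i j], its degree is gen_deg i j, and gen_vars
   i j is a set of variables separating its two monomials (u, v, u_i have
   index 0, 1, i.+1). *)
Definition gen_deg (i j : nat) : nat :=
  if i == 0%N then en j.-1 else (hn i + hn j.-1)%N.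

Definition gen_vars (i j v : nat) : bool :=
  if i == 0%N then if j == m.+1 then (v == 1%N) || (v == m.+1)
                   else (v == 0%N) || (v == j.+1)
  else (v == i.+1) || (v == j).

Definition gen_lhs (i j : nat) : 'X_{1..m.+2} :=
  (if i == 0%N then if j == m.+1 then U_(V 1) *+ Y m + U_(V m.+1)
                    else U_(V 0) *+ (X j - X j.-1) + U_(V j.+1)
   else U_(V i.+1) + U_(V j))%MM.

Definition gen_rhs (i j : nat) : 'X_{1..m.+2} :=
  (if i == 0%N then if j == m.+1 then U_(V 0) *+ (q - X m)
                    else if j == 1%N then U_(V 1) *+ (p - Y 1)
                    else U_(V 1) *+ (Y j.-1 - Y j) + U_(V j)
   else U_(V 0) *+ (q - X i - X j.-1) + U_(V 1) *+ (p - Y i - Y j.-1))%MM.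

Lemma corner_int j : (j <= m)%N -> (en j)%:Z = e j.
Proof.
move=> jm; rewrite /corner gez0_abs //.
have := stair_X2 st jm; have := @stair_Y2 _ _ _ _ _ st j.+1 jm; nia.
Qed.

Lemma KWgens_V0 : a (V 0) = p.
Proof. by rewrite /KWgens /= inordK. Qed.

Lemma KWgens_V1 : a (V 1) = q.
Proof. by rewrite /KWgens /= inordK. Qed.

Lemma KWgens_V i : (1 <= i <= m)%N -> a (V i.+1) = hn i.
Proof. by case: i => // i im; rewrite /KWgens /= inordK. Qed.

Lemma V_val k : (k <= m.+1)%N -> V k = k :> nat.
Proof. by move=> km; rewrite inordK. Qed.

Definition weightZ (v : nat) : int :=
  if v == 0%N then p%:Z else if v == 1%N then q%:Z else h v.-1.

Lemma weightZ_S l : (1 <= l)%N -> weightZ l.+1 = h l.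
Proof. by case: l. Qed.

Lemma weightZ_0 : weightZ 0 = p%:Z. Proof. by []. Qed.
Lemma weightZ_1 : weightZ 1 = q%:Z. Proof. by []. Qed.

Lemma KWgens_weight (v : 'I_m.+2) : (a v)%:Z = weightZ v.
Proof.
by case: v => [[|[|v]] vm] //=; rewrite /KWgens /= (KWh_stair st).
Qed.

Lemma index_cases v : (v < m.+2)%N ->
  [\/ v = 0%N, v = 1%N | exists2 l, (1 <= l <= m)%N & v = l.+1].
Proof.
by case: v => [|[|v]] vm; [apply: Or31|apply: Or32|apply: Or33; exists v.+1].
Qed.

(** A monomial of this degree containing both variables would put the difference in H. Each case is
    one of the differences excluded in [Staircase2]. *)
Lemma gen_vars_split i j v v' : (i < j)%N -> (j <= m.+1)%N -> (v' < m.+2)%N ->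
  gen_vars i j v -> ~~ gen_vars i j v' ->
  ~ sg ((gen_deg i j)%:Z - weightZ v - weightZ v').
Proof.
move=> ij jm v'm; rewrite /gen_vars /gen_deg.
have m0 : (1 <= m)%N by lia.
case: eqP => [i0|/eqP i0].
  rewrite corner_int; last by lia.
  case: eqP => [jE|/eqP jE].
    rewrite jE /=; case/orP => /eqP ->.
      case: (index_cases v'm) => [->|->|[l lm ->]] //= l1; rewrite ?weightZ_0 ?weightZ_1.
      - by have := stair_e_pq st (leqnn m); congr (~ sg _); ring.
      - by rewrite weightZ_S; [apply: (stair_em_q_h st)|]; lia.
    case: (index_cases v'm) => [->|->|[l lm ->]] //= l1; rewrite (weightZ_S m0) ?weightZ_0 ?weightZ_1.
    - exact: (stair_em_h_p st).
    - by rewrite weightZ_S; [apply: (stair_em_h_h st)|]; lia.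
  case: j ij jm jE => // j _ jm jE /=; have jm' : (j < m)%N by lia.
  case/orP => /eqP ->.
    case: (index_cases v'm) => [->|->|[l lm ->]] //= l1; rewrite ?weightZ_0 ?weightZ_1.
    - exact: (stair_e_pq st (ltnW jm')).
    - by rewrite weightZ_S; [apply: (stair_e_p_h st)|]; lia.
  rewrite (weightZ_S (ltn0Sn j)).
  case: (index_cases v'm) => [->|->|[l lm ->]] //= l1; rewrite ?weightZ_0 ?weightZ_1.
  - exact: (stair_e_h_q st).
  - by rewrite weightZ_S; [apply: (stair_e_h_h st)|]; lia.
have key k : (1 <= k <= m)%N -> ~~ ((v' == i.+1) || (v' == j)) ->
    (k = i \/ k = j.-1) -> ~ sg (h k - weightZ v').
  move=> km; case: (index_cases v'm) => [->|->|[l lm ->]] //= l1 kE; rewrite ?weightZ_0 ?weightZ_1.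
  - exact: (stair_h_p st km).
  - exact: (stair_h_q st km).
  rewrite weightZ_S; last by lia.
  by apply: (stair_h_h st km lm); lia.
rewrite PoszD !(KWh_stair st) //; try lia.
case/orP => /eqP -> nv'.
  rewrite weightZ_S; last by lia.
  rewrite [h i + _]addrC addrK; apply: key => //; [lia|by right].
have -> : j = j.-1.+1 by lia.
rewrite weightZ_S /=; last by lia.
by rewrite addrK; apply: key => //; [lia|left].
Qed.

Lemma gen_splits i j : (i < j)%N -> (j <= m.+1)%N ->
  splits a (gen_deg i j) (fun v => gen_vars i j v).
Proof.
move=> ij jm; apply: splits_criterion => v v' s Jv Jv' ms E.
apply: (gen_vars_split ij jm (ltn_ord v') Jv Jv').
rewrite -!KWgens_weight E.
have /(monoid_gen_stair st) := ms; congr sg.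
by rewrite !PoszD; ring.
Qed.

Lemma gen_lhs_deg i j : (i < j)%N -> (j <= m.+1)%N -> wdeg a (gen_lhs i j) = gen_deg i j.
Proof.
move=> ij jm; rewrite /gen_lhs /gen_deg.
have m0 : (1 <= m)%N by lia.
case: eqP => [i0|/eqP i0]; last first.
  rewrite wdegD !wdegU KWgens_V; last by lia.
  by rewrite -{1}(@prednK j) ?KWgens_V //; lia.
apply/eqP; rewrite -eqz_nat; apply/eqP.
rewrite corner_int; last by lia.
case: eqP => [jE|/eqP jE]; rewrite wdegD wdegUn wdegU.
  rewrite KWgens_V1 KWgens_V; last by lia.
  rewrite PoszD PoszM (KWh_stair st); last by lia.
  by rewrite jE /= (stair_Ym st); ring.
rewrite KWgens_V0 KWgens_V; last by lia.
rewrite PoszD PoszM (KWh_stair st); last by lia.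
case: j ij jm jE => // j _ jm jE /=.
rewrite -subzn; first by ring.
by apply: (stair_Xle st).
Qed.

Lemma gen_rhs_deg i j : (i < j)%N -> (j <= m.+1)%N -> wdeg a (gen_rhs i j) = gen_deg i j.
Proof.
move=> ij jm; rewrite /gen_rhs /gen_deg.
have m0 : (1 <= m)%N by lia.
case: eqP => [i0|/eqP i0]; apply/eqP; rewrite -eqz_nat; apply/eqP; last first.
  rewrite wdegD !wdegUn KWgens_V0 KWgens_V1 !PoszD !PoszM !(KWh_stair st); try lia.
  have im : (i <= m)%N by lia.
  have jm' : (j.-1 <= m)%N by lia.
  have Xi := stair_X2 st im; have Xj := stair_X2 st jm'.
  have Yi := @stair_Y2 _ _ _ _ _ st i.
  have Yj := @stair_Y2 _ _ _ _ _ st j.-1.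
  have {}Yi : (2 * Y i <= p)%N by apply: Yi; lia.
  have {}Yj : (2 * Y j.-1 <= p)%N by apply: Yj; lia.
  have -> : (q - X i - X j.-1)%N%:Z = q%:Z - (X i)%:Z - (X j.-1)%:Z by lia.
  have -> : (p - Y i - Y j.-1)%N%:Z = p%:Z - (Y i)%:Z - (Y j.-1)%:Z by lia.
  by ring.
rewrite corner_int; last by lia.
case: eqP => [jE|/eqP jE].
  rewrite wdegUn KWgens_V0 jE /= (stair_Ym st) PoszM -subzn; first by ring.
  by have := stair_X2 st (leqnn m); lia.
case: eqP => [j1|/eqP j1].
  rewrite wdegUn KWgens_V1 j1 /= (stair_X0 st) PoszM -subzn; first by ring.
  by have := @stair_Y2 _ _ _ _ _ st 1 isT; lia.
rewrite wdegD wdegUn wdegU KWgens_V1 -{3}(@prednK j); last by lia.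
rewrite KWgens_V; last by lia.
rewrite PoszD PoszM (KWh_stair st); last by lia.
case: j ij jm jE j1 => // j _ jm jE j1 /=.
rewrite -subzn; first by ring.
by apply: (stair_Yle st).
Qed.

(** This is the Kronecker delta required by [generators_matching]. Degrees of distinct generators
    may coincide, for instance some h_i + h_k with some e_j; the supports then have to tell them
    apart. *)
Lemma gen_dual i j i' j' : (i < j)%N -> (j <= m.+1)%N ->
  (i' < j')%N -> (j' <= m.+1)%N -> gen_deg i j = gen_deg i' j' ->
  supp_in (fun v => gen_vars i' j' v) (gen_lhs i j) = (i == i') && (j == j') /\
  supp_in (fun v => gen_vars i' j' v) (gen_rhs i j) = false.
Proof.
move=> ij jm ij' jm' dE.
have p0 := stair_p st; have q0 := stair_q st.
have m0 : (1 <= m)%N by lia.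
have ltX t : (t <= m)%N -> (X t < X t.+1)%N by move=> tm; apply: (stair_X st).
have ltY t : (t <= m)%N -> (Y t.+1 < Y t)%N by move=> tm; apply: (stair_Y st).
have Xm := ltX m (leqnn m); rewrite (stair_Xm st) in Xm.
have Ym := ltY m (leqnn m); rewrite (stair_Ym st) in Ym.
have Y1 := ltY 0%N (leq0n m); rewrite (stair_Y0 st) in Y1.
set J : pred 'I_m.+2 := fun v => gen_vars i' j' v.
have Vv k : (k <= m.+1)%N -> J (V k) = gen_vars i' j' k.
  by move=> km; rewrite /J V_val.
have [i0|i0] := posnP i.
  have nX : (i == 0)%N && (j != m.+1) -> (X j - X j.-1 == 0)%N = false.
    by move=> jm1; have := ltX j.-1; rewrite prednK; lia.
  have nY : (i == 0)%N && (j != m.+1) -> (Y j.-1 - Y j == 0)%N = false.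
    by move=> jm1; have := ltY j.-1; rewrite prednK; lia.
  have nq : (q - X m == 0)%N = false by lia.
  have nYm : (Y m == 0)%N = false by lia.
  have np : (p - Y 1 == 0)%N = false by lia.
  have [i'0|i'0] := posnP i'.
    have jj : j = j'.
      move: dE; rewrite /gen_deg i0 i'0 /= => /(congr1 Posz).
      by rewrite !corner_int; [move/(stair_e_inj st)|..]; lia.
    subst j' i i'; rewrite eqxx /=.
    have [jE|jE] := eqVneq j m.+1.
      rewrite /gen_lhs /gen_rhs /= jE eqxx supp_inD !supp_in_Un supp_in_U !Vv //.
      by rewrite /gen_vars jE !eqxx /=; split; lia.
    rewrite /gen_lhs /gen_rhs /= (negbTE jE) supp_inD !supp_in_Un supp_in_U.
    rewrite !Vv; try lia.
    split; first by rewrite /gen_vars /= (negbTE jE) !eqxx orbT.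
    have J1 : gen_vars 0 j 1 = false by rewrite /gen_vars /= (negbTE jE); lia.
    case: ifP => [j1|j1]; first by rewrite supp_in_Un Vv // np J1.
    by rewrite supp_inD supp_in_Un Vv // J1 nY ?jE.
  have v0 : gen_vars i' j' 0 = false by rewrite /gen_vars eqn0Ngt i'0 /=; lia.
  have v1 : gen_vars i' j' 1 = false by rewrite /gen_vars eqn0Ngt i'0 /=; lia.
  have -> : (i == i') && (j == j') = false by lia.
  rewrite /gen_lhs /gen_rhs i0 /=; have [jE|jE] := eqVneq j m.+1.
    by rewrite supp_inD !supp_in_Un !Vv // v0 v1 nq nYm.
  rewrite supp_inD supp_in_Un Vv // v0 nX ?i0 //; split=> //.
  by case: ifP => j1; rewrite ?supp_inD supp_in_Un Vv // v1 ?np // nY ?i0.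
have im : (i <= m)%N by lia.
have j1m : (j.-1 <= m)%N by lia.
have Xi := stair_X2 st im; have Xj := stair_X2 st j1m.
have Yi : (2 * Y i <= p)%N by apply: (stair_Y2 st); lia.
have Yj : (2 * Y j.-1 <= p)%N by apply: (stair_Y2 st); lia.
have -> : gen_lhs i j = (U_(V i.+1) + U_(V j))%MM by rewrite /gen_lhs eqn0Ngt i0.
have -> : gen_rhs i j = (U_(V 0) *+ (q - X i - X j.-1) + U_(V 1) *+ (p - Y i - Y j.-1))%MM.
  by rewrite /gen_rhs eqn0Ngt i0.
rewrite !supp_inD !supp_in_Un !supp_in_U !Vv //; try lia.
have dZ : h i + h j.-1 = (gen_deg i' j')%:Z.
  by rewrite -dE /gen_deg; case: eqP => [|_]; [lia|rewrite PoszD !(KWh_stair st); lia].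
have [i'0|i'0] := posnP i'; last first.
  have v0 : gen_vars i' j' 0 = false by rewrite /gen_vars eqn0Ngt i'0 /=; lia.
  have v1 : gen_vars i' j' 1 = false by rewrite /gen_vars eqn0Ngt i'0 /=; lia.
  have dZ' : h i + h j.-1 = h i' + h j'.-1.
    by rewrite dZ /gen_deg; case: eqP => [|_]; [lia|rewrite PoszD !(KWh_stair st); lia].
  have hI k l : (1 <= k <= m)%N -> (1 <= l <= m)%N -> h k = h l -> k = l.
    move=> km lm kl; have [//|/eqP ne] := eqVneq k l.
    by case: (stair_h_h st km lm (fun E => ne (esym E))); rewrite kl subrr; apply: (stair_sg0 st).
  rewrite v0 v1 !orbF; split; last first.
    (* Neither u nor v is in the set, so both exponents would be 0: X_i + X_(j-1) = q forces i = m,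
       and then Y_i + Y_(j-1) < p. *)
    apply/negbTE/negP => /andP[E1 E2].
    have iE : i = m.
      have [//|ne] := eqVneq i m.
      have Xi2 : (2 * X i < q)%N by apply: (stair_lt_q st m2); lia.
      by lia.
    have Ym2 : (2 * Y m < p)%N by apply: (stair_lt_p st m2); lia.
    by rewrite iE in E2; lia.
  have i'n : (i' == 0)%N = false by lia.
  apply/idP/idP; rewrite /gen_vars i'n; last first.
    by case/andP=> /eqP -> /eqP ->; rewrite !eqxx orbT.
  case/andP; case/orP => /eqP E1; case/orP => /eqP E2.
  - have ij1 : j.-1 = i by lia.
    have ii' : i = i' by lia.
    have := hI j'.-1 i; rewrite ij1 ii' in dZ' *.
    have {}dZ' : h j'.-1 = h i' by move: dZ'; lia.
    by move=> /(_ _ _ dZ') ?; lia.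
  - by lia.
  - by lia.
  - have ij1 : j.-1 = i by lia.
    have ii' : j'.-1 = i by lia.
    have := hI i i'; rewrite ij1 ii' in dZ'.
    have {}dZ' : h i = h i' by move: dZ'; lia.
    by move=> /(_ _ _ dZ') ?; lia.
have dE' : h i + h j.-1 = e j'.-1.
  by rewrite dZ /gen_deg i'0 /= corner_int //; lia.
have Xi0 : (0 < X i)%N by rewrite -(stair_X0 st) (stair_X st) //; lia.
have -> : (i == i') && (j == j') = false by lia.
have [jE|/negbTE jE] := eqVneq j' m.+1; rewrite /gen_vars i'0 /= ?jE ?eqxx; split.
- apply/negbTE/negP => /andP[H1 H2].
  have iE : i = m by lia.
  have jE' : j.-1 = m by lia.
  case: (@stair_h_q _ _ _ _ _ st m); first by lia.
  have -> : h m - q%:Z = 0%:Z + 0%:Z * p%:Z + ((Y m).-1)%:Z * q%:Z.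
    rewrite iE jE' jE /= (stair_Ym st) in dE'.
    have -> : ((Y m).-1)%:Z = (Y m)%:Z - 1 by lia.
    by lia.
  exact/stair_sgD/(stair_sg0 st).
- rewrite orbF orbT andbT; apply/negbTE/negP => H.
  rewrite jE /= (stair_Ym st) in dE'.
  have qE : q%:Z = (X i)%:Z + (X j.-1)%:Z by lia.
  have E : (X m)%:Z * p%:Z + (- (Y i)%:Z - (Y j.-1)%:Z) * q%:Z = 0.
    have -> : (- (Y i)%:Z - (Y j.-1)%:Z) * q%:Z
      = h i + h j.-1 - p%:Z * q%:Z - p%:Z * (q%:Z - (X i)%:Z - (X j.-1)%:Z) by ring.
    by rewrite dE' qE; ring.
  have [|E1 _] := coord_uniq (stair_cop st) q0 E; first by lia.
  by have := ltX 0%N; have := stair_Xle st m0 (leqnSn m); rewrite (stair_X0 st); lia.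
- apply/negbTE/negP => /andP[H1 H2].
  have iE : i = j' by lia.
  have jE' : j.-1 = j' by lia.
  case: (@stair_h_p _ _ _ _ _ st j'); first by lia.
  rewrite iE jE' in dE'.
  have ltj := ltX j'.-1; rewrite prednK in ltj; last by lia.
  have {}ltj : (X j'.-1 < X j')%N by apply: ltj; lia.
  have -> : h j' - p%:Z = 0%:Z + ((X j' - X j'.-1).-1)%:Z * p%:Z + 0%:Z * q%:Z.
    have -> : ((X j' - X j'.-1).-1)%:Z = (X j')%:Z - (X j'.-1)%:Z - 1 by lia.
    by move: dE'; rewrite prednK; lia.
  exact/stair_sgD/(stair_sg0 st).
- apply/negbTE/negP => H.
  have pE : p%:Z = (Y i)%:Z + (Y j.-1)%:Z by lia.
  have E : ((X i)%:Z + (X j.-1)%:Z - (X j'.-1)%:Z) * p%:Z - (Y j')%:Z * q%:Z = 0.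
    rewrite prednK in dE'; last by lia.
    have -> : ((X i)%:Z + (X j.-1)%:Z - (X j'.-1)%:Z) * p%:Z - (Y j')%:Z * q%:Z
      = pt (X j'.-1)%:Z (Y j')%:Z - (h i + h j.-1)
        + q%:Z * (p%:Z - (Y i)%:Z - (Y j.-1)%:Z) by ring.
    by rewrite dE' pE; ring.
  have Yj' : (2 * Y j' <= p)%N by apply: (stair_Y2 st); lia.
  have Yj'0 : (0 < Y j')%N by rewrite -(stair_Ym st) (stair_Y st) //; lia.
  rewrite -mulNr in E.
  by have [|] := coord_uniq (stair_cop st) q0 E; lia.
Qed.

End KWGenerators.

(** * Degrees of the entries of a homogeneous matrix whose minors lie in the defining ideal *)

Section Determinantal.
Variables (K : fieldType) (n : nat) (a : 'I_n -> nat).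
Variables (F G : 'I_n -> {mpoly K[n]}) (f g : 'I_n -> nat).
Hypothesis hF : forall j, F j \is ishomog1 (f j) (wdeg a).
Hypothesis hG : forall j, G j \is ishomog1 (g j) (wdeg a).
Hypothesis F0 : forall j, (F j)@_0%MM = 0.
Hypothesis G0 : forall j, (G j)@_0%MM = 0.
Variables (d : nat) (J : pred 'I_n) (i j : 'I_n).
Hypothesis sp : splits a d J.
Hypothesis minor_in : defining_ideal a (F i * G j - F j * G i).
Hypothesis minor_neq0 : (evJ a J (F i * G j - F j * G i))`_d != 0.

Let evF (L : pred 'I_n) k : evJ a L (F k) = (evJ a L (F k))`_(f k) *: 'X^(f k).
Proof. exact: evJ_homog. Qed.

Let evG (L : pred 'I_n) k : evJ a L (G k) = (evJ a L (G k))`_(g k) *: 'X^(g k).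
Proof. exact: evJ_homog. Qed.

Let evFG (L : pred 'I_n) k l : evJ a L (F k * G l)
  = ((evJ a L (F k))`_(f k) * (evJ a L (G l))`_(g l)) *: 'X^(f k + g l).
Proof. by rewrite evJM {1}evF {1}evG -scalerAl -scalerAr scalerA exprD. Qed.

Let vanish k l : evJ a predT (F k * G l) = 0 -> (evJ a J (F k * G l))`_d = 0.
Proof.
move/eqP; rewrite evJM mulf_eq0 => /orP[/eqP FI|/eqP GI].
  by rewrite mulrC splits_mul // G0 mul0r.
by rewrite splits_mul // F0 mul0r.
Qed.

(** If a product of entries vanishes on the curve, one factor is in the prime ideal I_H and the
    other in the irrelevant ideal, so the linear form kills it. As the form is nonzero on the minor,
    the two products have the same nonzero image, a multiple of one power of t; that power must be
    t^d. *)
Lemma minor_degrees : (f i + g j = f j + g i)%N /\ d = (f i + g j)%N.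
Proof.
have evE : evJ a predT (F i * G j) = evJ a predT (F j * G i).
  by apply/subr0_eq; rewrite -evJB; apply: minor_in.
have ev0 : evJ a predT (F i * G j) != 0.
  apply: contraNneq minor_neq0 => E.
  have V1 := vanish E; have V2 : (evJ a J (F j * G i))`_d = 0.
    by apply: vanish; rewrite -evE.
  by rewrite evJB coefB V1 V2 subrr.
have fg : (f i + g j = f j + g i)%N.
  have [//|ne] := eqVneq (f i + g j)%N (f j + g i)%N.
  have := congr1 (fun u : {poly K} => u`_(f i + g j)) evE.
  rewrite !evFG !coefZ !coefXn eqxx (negbTE ne) mulr0 mulr1 => c0.
  by move: ev0; rewrite evFG c0 scale0r eqxx.
split=> //; have [//|ne] := eqVneq d (f i + g j)%N.
move: minor_neq0; rewrite evJB coefB !evFG !coefZ !coefXn -fg (negbTE ne).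
by rewrite !mulr0 subrr eqxx.
Qed.

(** On the axis of v one of the two products survives. Both its factors have degrees that are
    positive multiples of a_v with sum 2 a_v, so each is a_v. *)
Lemma minor_square (v : 'I_n) : J =1 pred1 v -> d = (a v + a v)%N -> (0 < a v)%N ->
  (f i = a v /\ g j = a v) \/ (f j = a v /\ g i = a v).
Proof.
move=> JE dE a0; have [fg dfg] := minor_degrees.
have key k l : evJ a (pred1 v) (F k * G l) != 0 -> d = (f k + g l)%N ->
    f k = a v /\ g l = a v.
  rewrite evJM mulf_eq0 negb_or => /andP[Fk Gl].
  have [s s0 sE] := evJ_single (hF k) (F0 k) Fk.
  have [t t0 tE] := evJ_single (hG l) (G0 l) Gl.
  rewrite dE sE tE -mulnDl addnn -mul2n => /eqP; rewrite eqn_pmul2r // => /eqP st.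
  have -> : s = 1%N by lia.
  have -> : t = 1%N by lia.
  by rewrite mul1n.
have := minor_neq0; rewrite (evJ_eq _ _ JE) evJB.
have [E1|ne1] := eqVneq (evJ a (pred1 v) (F i * G j)) 0; last first.
  by left; apply: key.
have [E2|ne2] := eqVneq (evJ a (pred1 v) (F j * G i)) 0; last first.
  by right; apply: key; rewrite // -fg.
by rewrite E1 E2 subrr coef0 eqxx.
Qed.

End Determinantal.

Section KWDeterminantal.
Variables (K : fieldType) (p q m : nat) (xs ys : nat -> nat).
Local Notation X := (stairX q m xs).
Local Notation Y := (stairY p m ys).
Hypothesis st : staircase p q m X Y.
Hypothesis m2 : (2 <= m)%N.
Local Notation a := (@KWgens p q m.+2 xs ys).
Local Notation pt A B := (p%:Z * q%:Z - A * p%:Z - B * q%:Z).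
Local Notation e j := (pt (X j)%:Z (Y j.+1)%:Z).
Local Notation hn := (KWh p q xs ys).
Local Notation en := (corner p q m xs ys).
Local Notation dg := (gen_deg p q m xs ys).
Local Notation T := {mpoly K[m.+2]}.

Variables F G : 'I_m.+2 -> T.
Hypothesis hom : forall j, whomog a (F j) /\ whomog a (G j).
Hypothesis irr : forall j, irrelevant_ideal (F j) /\ irrelevant_ideal (G j).
Hypothesis gen : forall u : T,
  defining_ideal a u <-> ideal_gen (minor2 (two_rows F G)) u.

Local Notation P := {ij : 'I_m.+2 * 'I_m.+2 | (ij.1 < ij.2)%N}.
Let lo (k : P) : 'I_m.+2 := (val k).1.
Let hi (k : P) : 'I_m.+2 := (val k).2.
Let dP (k : P) := dg (lo k) (hi k).
Let JP (k : P) : pred 'I_m.+2 := fun v => gen_vars m (lo k) (hi k) v.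
Let M (k : P) : T := F (lo k) * G (hi k) - F (hi k) * G (lo k).

Let lt_lohi k : (lo k < hi k)%N. Proof. exact: (valP k). Qed.
Let hi_le k : (hi k <= m.+1)%N. Proof. by rewrite -ltnS. Qed.

Let M_in k : defining_ideal a (M k).
Proof.
apply/gen/ideal_gen_base/minor2E; exists (lo k), (hi k); split=> //.
Qed.

Let splitP k : splits a (dP k) (JP k).
Proof. exact: gen_splits. Qed.

Lemma minors_matching : exists s : P -> P, injective s /\
  forall r, (evJ a (JP (s r)) (M r))`_(dP (s r)) != 0.
Proof.
pose b k : T := 'X_[gen_lhs p q m xs ys (lo k) (hi k)]
  - 'X_[gen_rhs p q m xs ys (lo k) (hi k)].
have ww k : wdeg a (gen_lhs p q m xs ys (lo k) (hi k))
    = wdeg a (gen_rhs p q m xs ys (lo k) (hi k)).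
  by rewrite gen_lhs_deg ?gen_rhs_deg.
have bI k : defining_ideal a (b k).
  have sT (w : 'X_{1..m.+2}) : supp_in predT w.
    by apply/forallP => i; rewrite implybT.
  rewrite in_defining_ideal; apply/polyP => d.
  by rewrite evJ_binomial // !sT coef0 subrr.
apply: (generators_matching (b := b)) => //.
  move=> k l; rewrite evJ_binomial // gen_lhs_deg //.
  have [E|ne] := eqVneq (dg (lo k) (hi k)) (dP l); last first.
    have [kl|_] := eqVneq k l; first by rewrite kl eqxx in ne.
    by rewrite subrr.
  have [-> ->] := gen_dual st m2 (lt_lohi k) (hi_le k) (lt_lohi l) (hi_le l) E.
  rewrite subr0 /= /lo /hi.
  by case: k l {E} => [[i j] ij] [[i' j'] ij'].
move=> k; have /gen := bI k; apply: ideal_gen_fintype => u /minor2E [i [j [ij ->]]].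
by exists (exist _ (i, j) ij).
Qed.

(** The shift from j to j - 1 in [gen_deg] turns the strict pairs i < j with i > 0 into the weak
    pairs i <= j - 1 of indices of the h. *)
Lemma gen_deg_sum (s : nat -> {poly int}) :
  \sum_(k : P) s (dP k) = \sum_(j < m.+1) s (en j)
    + \sum_(x < m) \sum_(y < m | (x <= y)%N) s (hn x.+1 + hn y.+1)%N.
Proof.
transitivity (\sum_(i < m.+2) \sum_(j < m.+2 | (i < j)%N) s (dg i j)).
  rewrite pair_big_dep /=.
  by rewrite (big_sub [pred ij : 'I_m.+2 * 'I_m.+2 | (ij.1 < ij.2)%N]).
rewrite big_ord_recl; congr (_ + _).
  rewrite big_mkcond big_ord_recl /= add0r; apply: eq_bigr => j _.
  by rewrite /bump /= add1n.
rewrite big_ord_recr /= [X in _ + X]big1 ?addr0 => [|j]; last first.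
  by rewrite /bump /=; have := ltn_ord j; lia.
apply: eq_bigr => i _; rewrite big_mkcond big_ord_recl /= add0r big_ord_recl /=.
rewrite /bump /= !add1n add0r [RHS]big_mkcond; apply: eq_bigr => j _ /=.
by rewrite /bump /= !add1n !ltnS /gen_deg.
Qed.

Lemma determinantal_arith : exists z k : int, k != 0 /\
  forall t, (t <= m)%N -> exists2 j, (j <= m)%N & e j = z + t%:Z * k.
Proof.
have m0 : (1 <= m)%N by lia.
have /fin_all_exists [f hF] j : exists d, F j \is ishomog1 d (wdeg a).
  by have [[d]] := hom j; exists d.
have /fin_all_exists [g hG] j : exists d, G j \is ishomog1 d (wdeg a).
  by have [_ [d]] := hom j; exists d.
have F0 j : (F j)@_0%MM = 0 by apply: irrelevant_coef0; apply: (irr j).1.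
have G0 j : (G j)@_0%MM = 0 by apply: irrelevant_coef0; apply: (irr j).2.
have [s [sI sM]] := minors_matching.
have deg k := minor_degrees hF hG F0 G0 (@splitP (s k)) (M_in k) (sM k).
have [s' sK s'K] := injF_bij sI.
have fgsym i j : (f i + g j = f j + g i)%N.
  have [ij|ji|/val_inj -> //] := ltngtP i j.
    by have [] := deg (exist _ (i, j) ij).
  by have [] := deg (exist _ (j, i) ji).
have multi : \sum_(i < m.+2) \sum_(j < m.+2 | (i < j)%N) 'X^(f i + g j)
    = \sum_(j < m.+1) 'X^(en j)
      + \sum_(x < m) \sum_(y < m | (x <= y)%N) 'X^(hn x.+1 + hn y.+1) :> {poly int}.
  rewrite -(gen_deg_sum (fun d => 'X^d)) (reindex_inj sI) /= pair_big_dep /=.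
  rewrite (big_sub [pred ij : 'I_m.+2 * 'I_m.+2 | (ij.1 < ij.2)%N]).
  by apply: eq_bigr => k _; have [_ ->] := deg k.
have hI : injective (fun x : 'I_m => hn x.+1).
  move=> x y xy; apply: val_inj => /=; have [//|/eqP ne] := eqVneq (x : nat) y.
  case: (@stair_h_h _ _ _ _ _ st x.+1 y.+1); rewrite ?ltn_ord //; first by lia.
  by rewrite -!(KWh_stair st) ?ltn_ord // xy subrr; apply: (stair_sg0 st).
have hpos (x : 'I_m) : (0 < hn x.+1)%N.
  rewrite lt0n; apply/eqP => h0; have xm := ltn_ord x.
  have /(congr1 Posz) := h0; rewrite (KWh_stair st) // => h0'.
  have E : (X x.+1)%:Z * p%:Z + ((Y x.+1)%:Z - p%:Z) * q%:Z = 0.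
    by move: h0'; lia.
  have Xx := stair_X2 st xm; have q0 := stair_q st.
  have X0 : (0 < X x.+1)%N by rewrite -(stair_X0 st) (stair_X st) // ltnW.
  by have [|] := coord_uniq (stair_cop st) q0 E; lia.
have eI : injective (fun j : 'I_m.+1 => en j).
  move=> i j /(congr1 Posz); have im := ltn_ord i; have jm := ltn_ord j.
  rewrite !(corner_int st) //= => E; apply: val_inj.
  exact: (stair_e_inj st im jm E).
(* The pair (x + 1, x + 2) is the relation for the square of u_(x+1), whose set of variables is a
   single one; s' gives the minor matched with it. *)
have sq (x : 'I_m) : exists i j, i <> j /\ (f i = hn x.+1 /\ g j = hn x.+1).
  pose v : 'I_m.+2 := lift ord0 (lift ord0 x).
  have vE : v = x.+2 :> nat by [].
  have uv : ((inord x.+1 : 'I_m.+2) < v)%N by rewrite vE inordK; have := ltn_ord x; lia.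
  pose k : P := exist (fun ij : 'I_m.+2 * 'I_m.+2 => (ij.1 < ij.2)%N) (inord x.+1, v) uv.
  have lok : lo k = x.+1 :> nat by rewrite /lo /= inordK; have := ltn_ord x; lia.
  have av : a v = hn x.+1 by [].
  have JE : JP (s (s' k)) =1 pred1 v.
    by move=> w; rewrite s'K /JP /gen_vars lok /= orbb.
  have dE : dP (s (s' k)) = (a v + a v)%N by rewrite s'K /dP /gen_deg lok.
  have := minor_square hF hG F0 G0 (@splitP (s (s' k))) (M_in (s' k)) (sM (s' k)) JE dE.
  rewrite av => /(_ (hpos x)) [E|E]; do 2 eexists; split; try exact: E.
    by move=> E'; have := lt_lohi (s' k); rewrite E' ltnn.
  by move=> E'; have := lt_lohi (s' k); rewrite E' ltnn.
(* Stated for arbitrary rows so that they can be exchanged: delta is a natural number, while the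
   sign of deg F_i - deg G_i is unknown. *)
have main (f' g' : 'I_m.+2 -> nat) (delta : nat) :
    (forall i, f' i = g' i + delta)%N ->
    \sum_(i < m.+2) \sum_(j < m.+2 | (i < j)%N) 'X^(f' i + g' j)
    = \sum_(j < m.+1) 'X^(en j)
      + \sum_(x < m) \sum_(y < m | (x <= y)%N) 'X^(hn x.+1 + hn y.+1) :> {poly int} ->
    (forall x : 'I_m, exists i j, i <> j /\ (f' i = hn x.+1 /\ g' j = hn x.+1)) ->
    exists z k : int, k != 0 /\
      forall t, (t <= m)%N -> exists2 j, (j <= m)%N & e j = z + t%:Z * k.
  move=> fg' multi' /fin_all_exists [u] /fin_all_exists [w uw].
  have uE x : (g' (u x) + delta)%N = hn x.+1 by have [_ [<- _]] := uw x.
  have wE x : g' (w x) = hn x.+1 by have [_ [_ <-]] := uw x.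
  have {}multi' : \sum_(i < m.+2) \sum_(j < m.+2 | (i < j)%N) 'X^(g' i + g' j + delta)
    = \sum_(j < m.+1) 'X^(en j)
      + \sum_(x < m) \sum_(y < m | (x <= y)%N) 'X^(hn x.+1 + hn y.+1) :> {poly int}.
    rewrite -multi'; apply: eq_bigr => i _; apply: eq_bigr => j _.
    by rewrite fg' addnAC.
  have d0 := degrees_delta eI hI multi' uE wE m2 (fun x => (uw x).1).
  have [z zE] := degrees_arith eI hI multi' uE wE d0.
  exists z%:Z, delta%:Z; split; first by rewrite eqz_nat -lt0n.
  move=> t /zE [j jE]; have jm := ltn_ord j; exists (j : nat) => //.
  by rewrite -(corner_int st) // jE PoszD PoszM.
have [le|lt] := leqP (g ord0) (f ord0).
  apply: (main f g (f ord0 - g ord0)%N) => // i.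
  by have := fgsym i ord0; lia.
apply: (main g f (g ord0 - f ord0)%N).
- by move=> i; have := fgsym i ord0; lia.
- rewrite -multi; apply: eq_bigr => i _; apply: eq_bigr => j _.
  by rewrite fgsym addnC.
by move=> x; have [i [j [ij [fi gj]]]] := sq x; exists j, i; split=> // /esym.
Qed.

End KWDeterminantal.

(** * Generation by the minors in the KW_D case *)

Section Congruence.
Variables (R : comNzRingType) (S : R -> Prop).

Definition congr_mod (f g : R) : Prop := ideal_gen S (f - g).

Lemma cong_refl f : congr_mod f f.
Proof. by rewrite /congr_mod subrr; apply: ideal_gen0. Qed.

Lemma cong_sym f g : congr_mod f g -> congr_mod g f.
Proof. by rewrite /congr_mod -opprB => /ideal_genN; rewrite opprK. Qed.

Lemma cong_trans f g k : congr_mod f g -> congr_mod g k -> congr_mod f k.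
Proof.
rewrite /congr_mod => fg gk; have -> : f - k = (f - g) + (g - k) by ring.
exact: ideal_genD.
Qed.

Lemma cong_mul f g f' g' : congr_mod f f' -> congr_mod g g' ->
  congr_mod (f * g) (f' * g').
Proof.
rewrite /congr_mod => ff gg.
have -> : f * g - f' * g' = g * (f - f') + f' * (g - g') by ring.
by apply: ideal_genD; apply: ideal_genM.
Qed.

Lemma cong_mull f g g' : congr_mod g g' -> congr_mod (f * g) (f * g').
Proof. exact/cong_mul/cong_refl. Qed.

Lemma cong_exp f g k : congr_mod f g -> congr_mod (f ^+ k) (g ^+ k).
Proof.
move=> fg; elim: k => [|k IH]; first by rewrite !expr0; apply: cong_refl.
by rewrite !exprS; apply: cong_mul.
Qed.

End Congruence.

(* The degrees of the monomials of f are indexed by representatives r, and the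
   coefficients of f of each degree add up to 0. *)
Lemma defining_ideal_sub (K : fieldType) n (a : 'I_n -> nat)
    (S : {mpoly K[n]} -> Prop) :
  (forall w w', wdeg a w = wdeg a w' -> congr_mod S 'X_[w] 'X_[w']) ->
  forall f, defining_ideal a f -> ideal_gen S f.
Proof.
move=> cong f If.
pose r d := nth 0%MM [seq w <- msupp f | wdeg a w == d] 0.
have rE w : w \in msupp f -> wdeg a (r (wdeg a w)) = wdeg a w.
  move=> wf; set s := [seq w' <- msupp f | wdeg a w' == wdeg a w].
  have : r (wdeg a w) \in s.
    apply: mem_nth; rewrite size_filter -has_count; apply/hasP.
    by exists w.
  by rewrite mem_filter => /andP[/eqP].
pose B := (\max_(w <- msupp f) wdeg a w).+1.
have lB w : w \in msupp f -> (wdeg a w < B)%N.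
  by move=> wf; rewrite ltnS; apply: leq_bigmax_seq.
have rep0 : \sum_(w <- msupp f) f@_w *: 'X_[r (wdeg a w)] = 0 :> {mpoly K[n]}.
  transitivity (\sum_(d < B) (evJ a predT f)`_d *: 'X_[r d] : {mpoly K[n]}).
    rewrite (eq_bigr (fun d : 'I_B => \sum_(w <- msupp f)
        (f@_w * (wdeg a w == d)%:R) *: 'X_[r d])) => [|d _]; last first.
      rewrite evJ_coef scaler_suml; apply: eq_bigr => w _.
      suff -> : supp_in predT w by [].
      by apply/forallP => i; rewrite implybT.
    rewrite exchange_big /= big_seq [RHS]big_seq; apply: eq_bigr => w wf.
    rewrite (bigD1 (Ordinal (lB w wf))) //= eqxx mulr1 big1 ?addr0 // => d dw.
    rewrite [_ == _](_ : _ = false) ?mulr0 ?scale0r //.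
    by apply: contraNF dw => /eqP E; apply/eqP/val_inj.
  by rewrite (_ : evJ a predT f = 0) // big1 // => d _; rewrite coef0 scale0r.
rewrite -[f]subr0 -rep0 {1}[f]mpolyE -sumrB big_seq.
apply: (big_ind (ideal_gen S)); first exact: ideal_gen0.
  exact: ideal_genD.
move=> w wf; rewrite -scalerBr -mul_mpolyC; apply: ideal_genM.
by apply: cong; rewrite rE.
Qed.

(* w is the sequence v^(p - (n-1) y), u_1, ..., u_(n-2), u^(q - (n-1) x): the
   columns of the matrix are (u^x, v^y) and the pairs (w k, w (k+1)). *)
Section GeometricChain.
Variables (R : comNzRingType) (S : R -> Prop) (u v : R) (w : nat -> R).
Variables (m p q x y : nat).
Local Notation "f === g" := (congr_mod S f g) (at level 70).
Hypothesis px : (2 * (m * y) <= p)%N.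
Hypothesis qx : (2 * (m * x) <= q)%N.
Hypothesis m0 : (0 < m)%N.
Hypothesis w0 : w 0 = v ^+ (p - m.+1 * y).
Hypothesis wm : w m.+1 = u ^+ (q - m.+1 * x).
Hypothesis minor_ww : forall k l, (k <= m)%N -> (l <= m)%N ->
  w k * w l.+1 === w l * w k.+1.
Hypothesis minor_uv : forall k, (k <= m)%N -> u ^+ x * w k.+1 === w k * v ^+ y.

Let pmy : (m.+1 * y <= p)%N.
Proof. by nia. Qed.

Let qmx : (m.+1 * x <= q)%N.
Proof. by nia. Qed.

Lemma chain_shift j k : (k + j <= m.+1)%N ->
  u ^+ (j * x) * w (k + j)%N === v ^+ (j * y) * w k.
Proof.
elim: j => [|j IH] kj; first by rewrite addn0; apply: cong_refl.
apply: cong_trans (_ : v ^+ y * (u ^+ (j * x) * w (k + j)%N) === _).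
  rewrite mulSn exprD addnS.
  have -> : v ^+ y * (u ^+ (j * x) * w (k + j)%N)
    = u ^+ (j * x) * (w (k + j)%N * v ^+ y) by ring.
  have -> : u ^+ x * u ^+ (j * x) * w (k + j).+1
    = u ^+ (j * x) * (u ^+ x * w (k + j).+1) by ring.
  by apply/cong_mull/minor_uv; lia.
by rewrite mulSn exprD -mulrA; apply/cong_mull/IH; lia.
Qed.

(** The minors move the two indices in opposite directions, so a product depends only on i + j; one
    index is pushed to an end of the chain, where w is a pure power. *)
Lemma chain_low i j : (i + j <= m.+1)%N -> w i * w j === w 0%N * w (i + j)%N.
Proof.
elim: i j => [|i IH] j ij; first exact: cong_refl.
apply: cong_trans (_ : w i * w j.+1 === _).
  by rewrite mulrC; apply: minor_ww; lia.
by rewrite addSnnS; apply: IH; lia.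
Qed.

Lemma chain_high i j : (i <= m.+1)%N -> (j <= m.+1)%N -> (m.+1 <= i + j)%N ->
  w i * w j === w (i + j - m.+1)%N * w m.+1.
Proof.
move=> im; have [d] : exists d, d = (m.+1 - i)%N by exists (m.+1 - i)%N.
elim: d i j im => [|d IH] i j im dE jm ij.
  have -> : i = m.+1 by lia.
  by rewrite mulrC addKn; apply: cong_refl.
case: j jm ij => [|j] jm ij; first by lia.
apply: cong_trans (_ : w i.+1 * w j === _).
  by rewrite [X in _ X]mulrC; apply: minor_ww; lia.
by rewrite -addSnnS; apply: IH; lia.
Qed.

Definition pure f := exists a b, f === u ^+ a * v ^+ b.

Lemma chain_pure_v k s : (1 <= k <= m.+1)%N -> ((m.+1 - k) * y <= s)%N ->
  pure (v ^+ s * w k).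
Proof.
move=> /andP[k1 km] le.
have := @chain_shift (m.+1 - k) k; rewrite subnKC // => /(_ (leqnn _)) H.
exists ((m.+1 - k) * x + (q - m.+1 * x))%N, (s - (m.+1 - k) * y)%N.
rewrite -{1}(subnK le) !exprD -wm.
have -> : v ^+ (s - (m.+1 - k) * y) * v ^+ ((m.+1 - k) * y) * w k
  = v ^+ (s - (m.+1 - k) * y) * (v ^+ ((m.+1 - k) * y) * w k) by ring.
rewrite [X in _ === X]mulrC.
by apply/cong_mull/cong_sym.
Qed.

Lemma chain_pure_u k s : (k <= m)%N -> (k * x <= s)%N -> pure (u ^+ s * w k).
Proof.
move=> km le.
have := @chain_shift k 0; rewrite add0n w0 => /(_ (leqW km)) H.
exists (s - k * x)%N, (k * y + (p - m.+1 * y))%N.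
rewrite -{1}(subnK le) !exprD -!mulrA.
exact: cong_mull.
Qed.

Lemma pure_mul f a b : pure f -> pure (u ^+ a * v ^+ b * f).
Proof.
case=> c [d E]; exists (a + c)%N, (b + d)%N.
have -> : u ^+ (a + c) * v ^+ (b + d) = u ^+ a * v ^+ b * (u ^+ c * v ^+ d).
  by rewrite !exprD; ring.
exact: cong_mull.
Qed.

Lemma pure_cong f g : f === g -> pure g -> pure f.
Proof. by move=> fg [a [b E]]; exists a, b; apply: cong_trans fg E. Qed.

(** The end power must be large enough to absorb the other factor w_k. In the low case k = i + j >=
    2, and (m + 1 - k) y <= p - (m + 1) y follows from 2 m y <= p; the high case has k <= m - 1 and
    uses 2 m x <= q. *)
Lemma chain_prod_pure i j : (1 <= i <= m)%N -> (1 <= j <= m)%N -> pure (w i * w j).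
Proof.
move=> im jm; have [le|lt] := leqP (i + j) m.+1.
  apply: pure_cong (chain_low le) _; rewrite w0.
  by apply: chain_pure_v; [lia|nia].
apply: pure_cong (chain_high _ _ _) _; try lia.
by rewrite wm mulrC; apply: chain_pure_u; [lia|nia].
Qed.

Lemma chain_uq_vp t : u ^+ (t * q) === v ^+ (t * p).
Proof.
rewrite mulnC exprM mulnC exprM; apply: cong_exp.
have := @chain_shift m.+1 0 (leqnn _); rewrite add0n w0 wm -!exprD.
by rewrite !subnKC.
Qed.

(** The bounds say that neither [chain_pure_u] nor [chain_pure_v] applies. Equivalently the degree
    has coordinates k x - a and (m + 1 - k) y - b that are both positive, which keeps it out of <p,
    q>. *)
Definition normal f := pure f \/ exists a b k,
  [/\ (1 <= k <= m)%N, (a < k * x)%N, (b < (m.+1 - k) * y)%N &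
      f === u ^+ a * v ^+ b * w k].

Lemma normal_cong f g : f === g -> normal g -> normal f.
Proof.
move=> fg [/(pure_cong fg)|[a [b [k [km ak bk E]]]]]; first by left.
by right; exists a, b, k; split=> //; apply: cong_trans fg E.
Qed.

Lemma normal_w a b k : (1 <= k <= m)%N -> normal (u ^+ a * v ^+ b * w k).
Proof.
move=> km; have [ak|ak] := ltnP a (k * x); last first.
  left; have -> : u ^+ a * v ^+ b * w k = u ^+ 0 * v ^+ b * (u ^+ a * w k) by ring.
  by apply/pure_mul/chain_pure_u => //; lia.
have [bk|bk] := ltnP b ((m.+1 - k) * y); last first.
  left; have -> : u ^+ a * v ^+ b * w k = u ^+ a * v ^+ 0 * (v ^+ b * w k) by ring.
  by apply/pure_mul/chain_pure_v => //; lia.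
by right; exists a, b, k; split=> //; apply: cong_refl.
Qed.

Lemma normal_mul_uv a b f : normal f -> normal (u ^+ a * v ^+ b * f).
Proof.
case=> [/(pure_mul a b)|[c [d [k [km _ _ E]]]]]; first by left.
apply: normal_cong (cong_mull _ E) _.
have -> : u ^+ a * v ^+ b * (u ^+ c * v ^+ d * w k)
  = u ^+ (a + c) * v ^+ (b + d) * w k by rewrite !exprD; ring.
exact: normal_w.
Qed.

Lemma normal_mul_w f k : (1 <= k <= m)%N -> normal f -> normal (w k * f).
Proof.
move=> km [[a [b E]]|[c [d [l [lm _ _ E]]]]].
  apply: normal_cong (cong_mull _ E) _.
  by rewrite mulrC; apply: normal_w.
left; apply: pure_cong (cong_mull _ E) _.
have -> : w k * (u ^+ c * v ^+ d * w l) = u ^+ c * v ^+ d * (w k * w l) by ring.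
by apply/pure_mul/chain_prod_pure.
Qed.

Lemma pure_cong_same_deg a b a' b' : coprime p q -> (0 < p)%N -> (0 < q)%N ->
  (a * p + b * q = a' * p + b' * q)%N -> (a <= a')%N ->
  u ^+ a * v ^+ b === u ^+ a' * v ^+ b'.
Proof.
move=> cpq p0 q0 E aa.
have E' : (a'%:Z - a%:Z) * p%:Z + (b'%:Z - b%:Z) * q%:Z = 0 by lia.
have [t [ta tb]] := lin_comb_coprime cpq E' q0.
have t0 : 0 <= t by nia.
have -> : a' = (a + `|t|%N * q)%N by apply/eqP; rewrite -eqz_nat PoszD PoszM; lia.
have -> : b = (b' + `|t|%N * p)%N by apply/eqP; rewrite -eqz_nat PoszD PoszM; lia.
rewrite !exprD.
have -> : u ^+ a * u ^+ (`|t|%N * q) * v ^+ b' = u ^+ a * v ^+ b' * u ^+ (`|t|%N * q).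
  by ring.
rewrite mulrA; apply/cong_mull/cong_sym; exact: chain_uq_vp.
Qed.

Lemma reduced_cong a b a' b' k l : (l <= k <= m.+1)%N ->
  (a = a' + (k - l) * x)%N -> (b' = b + (k - l) * y)%N ->
  u ^+ a * v ^+ b * w k === u ^+ a' * v ^+ b' * w l.
Proof.
move=> /andP[lk km] -> ->; rewrite !exprD.
have := @chain_shift (k - l) l; rewrite subnKC // => /(_ km) H.
have -> : u ^+ a' * u ^+ ((k - l) * x) * v ^+ b * w k
  = u ^+ a' * v ^+ b * (u ^+ ((k - l) * x) * w k) by ring.
have -> : u ^+ a' * (v ^+ b * v ^+ ((k - l) * y)) * w l
  = u ^+ a' * v ^+ b * (v ^+ ((k - l) * y) * w l) by ring.
exact: cong_mull.
Qed.

End GeometricChain.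

Section KWDGeneration.
Variables (K : fieldType) (p q m x y : nat).
Local Notation T := {mpoly K[m.+2]}.
Local Notation U := (var_u K m.+2).
Local Notation V := (var_v K m.+2).

Definition KWD_top (j : 'I_m.+2) : T :=
  match val j with
  | 0 => var_ui K m.+2 m
  | 1 => U ^+ x
  | 2 => V ^+ (p - m.+1 * y)
  | i.+2 => var_ui K m.+2 i
  end.

Definition KWD_bot (j : 'I_m.+2) : T :=
  match val j with
  | 0 => U ^+ (q - m.+1 * x)
  | 1 => V ^+ y
  | i.+1 => var_ui K m.+2 i
  end.

Lemma KWD_matrixE : KWD_matrix K p q m.+2 x y = two_rows KWD_top KWD_bot.
Proof. by rewrite /KWD_matrix subn2 subn1. Qed.

Definition KWD_chain (k : nat) : T :=
  if k == 0%N then V ^+ (p - m.+1 * y)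
  else if k == m.+1 then U ^+ (q - m.+1 * x) else var_ui K m.+2 k.

Lemma mvarE i (im : (i < m.+2)%N) : mvar K m.+2 i = 'X_(Ordinal im).
Proof. by rewrite /mvar insubT. Qed.

Lemma KWD_chain_col k : (1 <= m)%N -> (k <= m)%N ->
  exists j, KWD_top j = KWD_chain k /\ KWD_bot j = KWD_chain k.+1.
Proof.
move=> m0 km; have [->|km'] := eqVneq k m.
  exists ord0; rewrite /KWD_top /KWD_bot /KWD_chain /= eqxx.
  by split=> //; do 2 (case: eqP => [|_] //; first lia).
have k2 : (k.+2 < m.+2)%N by lia.
exists (Ordinal k2); rewrite /KWD_top /KWD_bot /KWD_chain /=.
by case: k km km' k2 => [|k] km km' k2 /=; split=> //; case: eqP => // E; lia.
Qed.

Local Notation cong := (congr_mod (minor2 (two_rows KWD_top KWD_bot))).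

Lemma minor_cong i j : cong (KWD_top i * KWD_bot j) (KWD_top j * KWD_bot i).
Proof.
have [ij|ji|/val_inj ->] := ltngtP i j; last exact: cong_refl.
  by apply/ideal_gen_base/minor2E; exists i, j.
by apply/cong_sym/ideal_gen_base/minor2E; exists j, i.
Qed.

Lemma KWD_chain_ww k l : (1 <= m)%N -> (k <= m)%N -> (l <= m)%N ->
  cong (KWD_chain k * KWD_chain l.+1) (KWD_chain l * KWD_chain k.+1).
Proof.
move=> m0 /(KWD_chain_col m0) [i [<- <-]] /(KWD_chain_col m0) [j [<- <-]].
exact: minor_cong.
Qed.

Lemma KWD_chain_uv k : (1 <= m)%N -> (k <= m)%N ->
  cong (U ^+ x * KWD_chain k.+1) (KWD_chain k * V ^+ y).
Proof.
move=> m0 /(KWD_chain_col m0) [i [<- <-]].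
exact: (minor_cong (lift ord0 ord0)).
Qed.

End KWDGeneration.

Section KWD.
Variables (K : fieldType) (p q m x y : nat) (xs ys : nat -> nat).
Local Notation T := {mpoly K[m.+2]}.
Local Notation a := (@KWgens p q m.+2 xs ys).
Local Notation X := (stairX q m xs).
Local Notation Y := (stairY p m ys).
Hypothesis st : staircase p q m X Y.
Local Notation u := (var_u K m.+2).
Local Notation v := (var_v K m.+2).
Local Notation ev := (evJ (K := K) a predT).
Local Notation w := (@KWD_chain K p q m x y).
Local Notation h i := (p%:Z * q%:Z - (X i)%:Z * p%:Z - (Y i)%:Z * q%:Z).

Lemma ev_mvar i (im : (i < m.+2)%N) : ev (mvar K m.+2 i) = 'X^(a (Ordinal im)).
Proof.
rewrite mvarE evJ_X wdegU; case: ifP => // /negP []; apply/forallP => j.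
by rewrite implybT.
Qed.

Lemma ev_Xn f k : ev (f ^+ k) = ev f ^+ k.
Proof. by rewrite /evJ rmorphXn. Qed.

Lemma ev_u : ev u = 'X^p.
Proof. by rewrite /var_u (@ev_mvar 0). Qed.

Lemma ev_v : ev v = 'X^q.
Proof. by rewrite /var_v (@ev_mvar 1). Qed.

Lemma ev_ui i : (1 <= i <= m)%N -> ev (var_ui K m.+2 i) = 'X^(KWh p q xs ys i).
Proof.
move=> /andP[i1 im]; rewrite /var_ui (@ev_mvar i.+1) //.
by case: i i1 im.
Qed.

Lemma Xn_inj i j : 'X^i = 'X^j :> {poly K} -> i = j.
Proof. by move=> /(congr1 (fun f : {poly K} => size f)); rewrite !size_polyXn => -[]. Qed.

(* Comparing degrees in the minor of the columns (u^x, v^y) and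
   (v^(p - (n-1) y), u_1). *)
Lemma KWD_matrix_first : (1 <= m)%N -> (2 * (m * y) <= p)%N -> (0 < y)%N ->
  (forall f : T, ideal_gen (minor2 (KWD_matrix K p q m.+2 x y)) f ->
     defining_ideal a f) ->
  X 1 = x /\ Y 1 = (m * y)%N.
Proof.
move=> m0 py y0 sub.
have := sub (@KWD_top K p m x y (lift ord0 ord0) * @KWD_bot K q m x y (lift ord0 (lift ord0 (Ordinal m0)))
  - @KWD_top K p m x y (lift ord0 (lift ord0 (Ordinal m0))) * @KWD_bot K q m x y (lift ord0 ord0)).
rewrite KWD_matrixE in_defining_ideal => H.
have {H}: ev (u ^+ x * var_ui K m.+2 1) = ev (v ^+ (p - m.+1 * y) * v ^+ y).
  apply/subr0_eq; rewrite -evJB; apply: H; apply/ideal_gen_base/minor2E.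
  by do 2 eexists; split; last reflexivity.
rewrite !evJM !ev_Xn ev_u ev_v ev_ui ?m0 // -!exprM -!exprD => /Xn_inj /(congr1 Posz).
rewrite !PoszD !PoszM (KWh_stair st) ?m0 // => E.
have Y1 := @stair_Y2 _ _ _ _ _ st 1 isT; have X1 := stair_X2 st m0.
have p0 := stair_p st; have q0 := stair_q st.
have Y0 : (0 < Y 1)%N.
  by have := @stair_Y _ _ _ _ _ st 1 m.+1 m0 (leqnn _); rewrite (stair_Ym st).
have pmy : (m.+1 * y <= p)%N by nia.
have E' : (x%:Z - (X 1)%:Z) * p%:Z + ((m * y)%N%:Z - (Y 1)%:Z) * q%:Z = 0.
  move: E; rewrite -subzn // !PoszM => E.
  rewrite -(addn1 m) PoszD in E.
  by lia.
have [|xX yY] := coord_uniq (stair_cop st) q0 E'; first by lia.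
by split; lia.
Qed.

Hypothesis xE : forall i, (1 <= i <= m)%N -> X i = (i * x)%N /\ Y i = ((m.+1 - i) * y)%N.
Hypothesis m0 : (1 <= m)%N.

Let px : (2 * (m * y) <= p)%N.
Proof. by have [_ E] := @xE 1 ltac:(lia); have := @stair_Y2 _ _ _ _ _ st 1 isT; rewrite E; lia. Qed.

Let qx : (2 * (m * x) <= q)%N.
Proof.
by have [E _] := @xE m ltac:(lia); have := stair_X2 st (leqnn m); rewrite E; lia.
Qed.

Local Notation S := (minor2 (two_rows (@KWD_top K p m x y) (@KWD_bot K q m x y))).
Local Notation cong := (congr_mod S).

Let hE i : (1 <= i <= m)%N -> (KWh p q xs ys i)%:Z
   = p%:Z * q%:Z - (i%:Z * x%:Z) * p%:Z - ((m%:Z + 1 - i%:Z) * y%:Z) * q%:Z.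
Proof.
move=> im; rewrite (KWh_stair st) //; have [-> ->] := xE im; rewrite !PoszM.
by have -> : (m.+1 - i)%N%:Z = m%:Z + 1 - i%:Z by lia.
Qed.

Definition chain_deg (k : nat) : int :=
  p%:Z * q%:Z - (k%:Z * x%:Z) * p%:Z - ((m%:Z + 1 - k%:Z) * y%:Z) * q%:Z.

Lemma ev_chain k : (k <= m.+1)%N -> exists2 d, d%:Z = chain_deg k & ev (w k) = 'X^d.
Proof.
move=> km; rewrite /KWD_chain /chain_deg.
have pmy : (m.+1 * y <= p)%N by nia.
have qmx : (m.+1 * x <= q)%N by nia.
case: eqP => [->|/eqP k0].
  exists (q * (p - m.+1 * y))%N; last by rewrite ev_Xn ev_v exprM.
  by rewrite PoszM -subzn // PoszM; lia.
case: eqP => [->|/eqP km'].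
  exists (p * (q - m.+1 * x))%N; last by rewrite ev_Xn ev_u exprM.
  by rewrite PoszM -subzn // PoszM; lia.
by exists (KWh p q xs ys k); [rewrite hE //; lia|rewrite ev_ui //; lia].
Qed.

Lemma KWD_minors_in f : ideal_gen S f -> defining_ideal a f.
Proof.
apply: ideal_gen_min.
- by rewrite in_defining_ideal /evJ raddf0.
- by move=> f1 f2; rewrite !in_defining_ideal evJD => -> ->; rewrite addr0.
- by move=> c f1; rewrite !in_defining_ideal evJM => ->; rewrite mulr0.
have col j : exists s t : nat,
    [/\ ev (@KWD_top K p m x y j) = 'X^s, ev (@KWD_bot K q m x y j) = 'X^t & t%:Z - s%:Z = y%:Z * q%:Z - x%:Z * p%:Z].
  have [j1|j1] := eqVneq (val j) 1%N.
    exists (p * x)%N, (q * y)%N; rewrite /KWD_top /KWD_bot j1 !ev_Xn ev_u ev_v -!exprM.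
    by split=> //; rewrite !PoszM; ring.
  have [k km [-> ->]] : exists2 k, (k <= m)%N &
      @KWD_top K p m x y j = w k /\ @KWD_bot K q m x y j = w k.+1.
    case: j j1 => [[|[|j]] jm] //= _.
      exists m => //; rewrite /KWD_top /KWD_bot /KWD_chain /= eqxx.
      by split=> //; do 2 (case: eqP => [|_] //; first lia).
    exists j; first by lia.
    rewrite /KWD_top /KWD_bot /KWD_chain /=.
    by case: j jm => [|j] jm /=; split=> //; case: eqP => // E; lia.
  have [s sE ->] := ev_chain (leqW km); have [t tE ->] := @ev_chain k.+1 km.
  exists s, t; split=> //; rewrite sE tE /chain_deg -(addn1 k) PoszD; ring.
move=> f1 /minor2E [i [j [ij ->]]].
have [s [t [Ei Ei' E]]] := col i; have [s' [t' [Ej Ej' E']]] := col j.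
rewrite in_defining_ideal evJB !evJM Ei Ei' Ej Ej' -!exprD.
have -> : (s + t' = s' + t)%N by lia.
by rewrite subrr.
Qed.

Let chain_w0 : w 0 = v ^+ (p - m.+1 * y). Proof. by []. Qed.
Let chain_wm : w m.+1 = u ^+ (q - m.+1 * x).
Proof. by rewrite /KWD_chain /= eqxx. Qed.
Let chain_ui k : (1 <= k <= m)%N -> w k = var_ui K m.+2 k.
Proof. by rewrite /KWD_chain => km; do 2 (case: eqP => [|_]; first lia). Qed.

Let ww k l : (k <= m)%N -> (l <= m)%N -> cong (w k * w l.+1) (w l * w k.+1).
Proof. exact: KWD_chain_ww. Qed.
Let uv k : (k <= m)%N -> cong (u ^+ x * w k.+1) (w k * v ^+ y).
Proof. exact: KWD_chain_uv. Qed.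

Local Notation nf := (normal S u v w m x y).

Lemma monomial_normal (c : 'X_{1..m.+2}) : nf 'X_[c].
Proof.
have [d] := ubnP (mdeg c); elim: d c => // d IH c cd.
have [->|c0] := eqVneq c 0%MM.
  left; exists 0%N, 0%N; rewrite mpolyX0 !expr0 mul1r; exact: cong_refl.
have [i [c' cE]] := mnm_split_var c0.
have nf_f : nf 'X_[c'] by apply: IH; move: cd; rewrite cE mdegD mdeg1; lia.
rewrite cE mpolyXD; move: 'X_[c'] nf_f => f nf_f {c c' cd c0 cE}.
have : 'X_i = mvar K m.+2 i by rewrite mvarE; congr 'X_[U_(_)]; apply: val_inj.
case: i => [[|[|i]] im] /= ->.
- have := normal_mul_uv px qx m0 chain_w0 chain_wm uv 1 0 nf_f.
  by rewrite expr0 expr1 mulr1.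
- have := normal_mul_uv px qx m0 chain_w0 chain_wm uv 0 1 nf_f.
  by rewrite expr0 expr1 mul1r.
rewrite -[mvar _ _ _]/(var_ui K m.+2 i.+1) -chain_ui //.
by apply: (normal_mul_w px qx m0 chain_w0 chain_wm ww uv).
Qed.

Lemma cong_ev f g : cong f g -> ev f = ev g.
Proof. by move=> /KWD_minors_in; rewrite in_defining_ideal evJB => /subr0_eq. Qed.

Lemma ev_uvX i j : ev (u ^+ i * v ^+ j) = 'X^(i * p + j * q).
Proof. by rewrite evJM !ev_Xn ev_u ev_v -!exprM -exprD mulnC [(q * _)%N]mulnC. Qed.

Lemma monomial_cong (c c' : 'X_{1..m.+2}) : wdeg a c = wdeg a c' ->
  cong 'X_[c] 'X_[c'].
Proof.
have evX b : ev 'X_[b] = 'X^(wdeg a b).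
  by rewrite evJ_X; case: ifP => // /negP[]; apply/forallP => i; rewrite implybT.
have p0 := stair_p st; have q0 := stair_q st; have cpq := stair_cop st.
have pureE b i j : cong 'X_[b] (u ^+ i * v ^+ j) -> wdeg a b = (i * p + j * q)%N.
  by move/cong_ev; rewrite evX ev_uvX => /Xn_inj.
have redE b i j k : (1 <= k <= m)%N -> cong 'X_[b] (u ^+ i * v ^+ j * w k) ->
    (wdeg a b)%:Z = p%:Z * q%:Z - (k%:Z * x%:Z - i%:Z) * p%:Z
      - ((m%:Z + 1 - k%:Z) * y%:Z - j%:Z) * q%:Z.
  move=> km /cong_ev; rewrite evX evJM ev_uvX.
  have [|d dE ->] := @ev_chain k; first by lia.
  rewrite -exprD => /Xn_inj ->; rewrite !PoszD !PoszM dE /chain_deg; ring.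
(* The two kinds of normal form never share a degree: one degree lies in <p, q>, the other does
   not. *)
have purered b b' i j k i' j' : cong 'X_[b] (u ^+ i * v ^+ j) ->
    (1 <= k <= m)%N -> (i' < k * x)%N -> (j' < (m.+1 - k) * y)%N ->
    cong 'X_[b'] (u ^+ i' * v ^+ j' * w k) -> wdeg a b <> wdeg a b'.
  move=> /pureE bE km ik jk /(redE _ _ _ _ km) bE' E.
  have E' : (i%:Z + (k%:Z * x%:Z - i'%:Z)) * p%:Z
      + (j%:Z + ((m%:Z + 1 - k%:Z) * y%:Z - j'%:Z) - p%:Z) * q%:Z = 0.
    by rewrite -E bE in bE'; lia.
  have [t [ta tb]] := lin_comb_coprime cpq E' q0.
  have jk' : j'%:Z < (m%:Z + 1 - k%:Z) * y%:Z by nia.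
  have ik' : i'%:Z < k%:Z * x%:Z by nia.
  have ? : 1 <= t by nia.
  by nia.
(* The first coordinates lie in (0, q/2], so equal degrees have equal coordinates. The order l <= k
   is imposed by the natural subtraction k - l in [reduced_cong]. *)
have redred b b' i j k i' j' l : (l <= k)%N -> (1 <= l)%N -> (k <= m)%N ->
    (i < k * x)%N -> (j < (m.+1 - k) * y)%N ->
    (i' < l * x)%N -> (j' < (m.+1 - l) * y)%N ->
    cong 'X_[b] (u ^+ i * v ^+ j * w k) ->
    cong 'X_[b'] (u ^+ i' * v ^+ j' * w l) -> wdeg a b = wdeg a b' ->
    cong 'X_[b] 'X_[b'].
  move=> lk l1 km ik jk il jl H H' E.
  have km1 : (1 <= k <= m)%N by rewrite (leq_trans l1 lk).
  have lm1 : (1 <= l <= m)%N by rewrite l1 (leq_trans lk km).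
  have bE := redE _ _ _ _ km1 H; have bE' := redE _ _ _ _ lm1 H'.
  have E' : (k%:Z * x%:Z - i%:Z - (l%:Z * x%:Z - i'%:Z)) * p%:Z
      + ((m%:Z + 1 - k%:Z) * y%:Z - j%:Z - ((m%:Z + 1 - l%:Z) * y%:Z - j'%:Z)) * q%:Z = 0.
    by rewrite E bE' in bE; lia.
  have kxm : (k * x <= m * x)%N by rewrite leq_mul2r km orbT.
  have lxm : (l * x <= k * x)%N by rewrite leq_mul2r lk orbT.
  have [|Ei Ej] := coord_uniq cpq q0 E'; first by apply/orP; left; lia.
  apply: cong_trans H _; apply: cong_trans _ (cong_sym H').
  apply: (reduced_cong px qx m0 uv); first by lia.
    by nia.
  by nia.
move=> E; case: (monomial_normal c) => [[i [j H]]|[i [j [k [km ik jk H]]]]];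
  case: (monomial_normal c') => [[i' [j' H']]|[i' [j' [l [lm il jl H']]]]].
- have bE := pureE _ _ _ H; have bE' := pureE _ _ _ H'.
  have E' : (i * p + j * q = i' * p + j' * q)%N by rewrite -bE -bE'.
  apply: cong_trans H _; apply: cong_trans _ (cong_sym H').
  have [ii|ii] := leqP i i'.
    exact: (pure_cong_same_deg px qx m0 chain_w0 chain_wm uv).
  apply: cong_sym.
  by apply: (pure_cong_same_deg px qx m0 chain_w0 chain_wm uv) => //; apply: ltnW.
- by case: (purered c c' i j l i' j').
- by case: (purered c' c i' j' k i j).
- case/andP: km => k1 km; case/andP: lm => l1 lm; have [lk|kl] := leqP l k.
    exact: (redred c c' i j k i' j' l).
  by apply: cong_sym; apply: (redred c' c i' j' l i j k) => //; apply: ltnW.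
Qed.

Lemma KWD_generation (f : T) :
  defining_ideal a f <-> ideal_gen (minor2 (KWD_matrix K p q m.+2 x y)) f.
Proof.
rewrite KWD_matrixE; split; last exact: KWD_minors_in.
exact/defining_ideal_sub/monomial_cong.
Qed.

End KWD.

(** * Proof of the equivalence *)

Lemma variable_power_entry (K : fieldType) m (a : 'I_m.+2 -> nat) i k (f : {mpoly K[m.+2]}) :
  (i < m.+2)%N -> (0 < k)%N -> f = mvar K m.+2 i ^+ k ->
  whomog a f /\ irrelevant_ideal f.
Proof.
move=> im k0 ->; rewrite (mvarE _ im); split.
  exists (k * a (Ordinal im))%N; rewrite mpolyXn dhomogE msuppX /= wdegUn eqxx //.
case: k k0 => // k _; rewrite exprSr; apply/ideal_genM/ideal_gen_base.
by exists (Ordinal im).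
Qed.

Section KWDMatrixEntries.
Variables (K : fieldType) (p q m x y : nat) (a : 'I_m.+2 -> nat).
Hypotheses (m0 : (1 <= m)%N) (x0 : (0 < x)%N) (y0 : (0 < y)%N).
Hypotheses (xq : (m.+1 * x < q)%N) (yp : (m.+1 * y < p)%N).

Lemma KWD_top_entry j :
  whomog a (@KWD_top K p m x y j) /\ irrelevant_ideal (@KWD_top K p m x y j).
Proof.
have tac i k f := @variable_power_entry K m a i k f.
rewrite /KWD_top; case: j => [[|[|[|j]]] jm] /=.
- by apply: (tac m.+1 1%N); rewrite ?expr1.
- exact: (tac 0%N x).
- by apply: (tac 1%N (p - m.+1 * y)%N) => //; lia.
- by apply: (tac j.+2 1%N); rewrite ?expr1 //; lia.
Qed.

Lemma KWD_bot_entry j :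
  whomog a (@KWD_bot K q m x y j) /\ irrelevant_ideal (@KWD_bot K q m x y j).
Proof.
have tac i k f := @variable_power_entry K m a i k f.
rewrite /KWD_bot; case: j => [[|[|j]] jm] /=.
- by apply: (tac 0%N (q - m.+1 * x)%N) => //; lia.
- exact: (tac 1%N y).
- by apply: (tac j.+2 1%N); rewrite ?expr1.
Qed.

End KWDMatrixEntries.

(** Both progressions have m + 1 terms, so the ends of each are at most m steps of the other apart.
    This compares m |d| and m k in both directions and leaves the orientation open. *)
Lemma arith_progression_diff m (c d z k : int) : (1 <= m)%N -> 0 < k ->
  (forall g, (exists2 j : nat, (j <= m)%N & g = c + j%:Z * d) <->
     (exists2 t : nat, (1 <= t <= m.+1)%N & g = z + t%:Z * k)) -> k = `|d|.
Proof.
move=> m0 k0 eqv.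
have [t tm tE] : exists2 t : nat, (1 <= t <= m.+1)%N & c = z + t%:Z * k.
  by apply/eqv; exists 0%N; lia.
have [t' tm' tE'] : exists2 t : nat, (1 <= t <= m.+1)%N & c + m%:Z * d = z + t%:Z * k.
  by apply/eqv; exists m.
have [j jm jE] : exists2 j : nat, (j <= m)%N & z + k = c + j%:Z * d.
  by apply/eqv; exists 1%N; lia.
have [j' jm' jE'] : exists2 j : nat, (j <= m)%N & z + m.+1%:Z * k = c + j%:Z * d.
  by apply/eqv; exists m.+1 => //; lia.
have E1 : m%:Z * d = (t'%:Z - t%:Z) * k by lia.
have E2 : m%:Z * k = (j'%:Z - j%:Z) * d by lia.
have le1 : m%:Z * `|d| <= m%:Z * k.
  have -> : m%:Z * `|d| = `|m%:Z * d| by rewrite normrM.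
  by rewrite E1 normrM (gtr0_norm k0); apply: ler_wpM2r; lia.
have le2 : m%:Z * k <= m%:Z * `|d|.
  have -> : m%:Z * k = `|m%:Z * k| by rewrite ger0_norm //; nia.
  by rewrite E2 normrM; apply: ler_wpM2r; lia.
by nia.
Qed.

(** * The conditions expressed by the staircase of a given presentation *)

Section Presented.
Variables (p q m : nat) (xs ys : nat -> nat) (H : nat -> Prop).
Local Notation X := (stairX q m xs).
Local Notation Y := (stairY p m ys).
Local Notation sg := (stair_sg p q m X Y).
Local Notation pt A B := (p%:Z * q%:Z - A * p%:Z - B * q%:Z).
Hypotheses (p3 : (3 <= p)%N) (pq : (p < q)%N) (cpq : coprime p q).
Hypothesis hH : in_KW p q m.+2 xs ys H.

Let st : staircase p q m X Y.
Proof. by apply: (in_KW_staircase _ pq cpq hH); lia. Qed.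

Let m0 : (1 <= m)%N. Proof. exact: (stair_m st). Qed.

Lemma in_KW_sg s : H s <-> sg s%:Z.
Proof.
by case: hH => _ _ _ Hs _; split=> [/Hs/(monoid_gen_stair st)|/(monoid_gen_stair st)/Hs].
Qed.

Lemma stair_sg_ge0 g : sg g -> 0 <= g.
Proof.
case=> i [c [d [im ->]]].
have [->|i0] := posnP i; first by rewrite (stair_X0 st) (stair_Y0 st); nia.
have Xi := stair_X2 st im; have Yi : (2 * Y i <= p)%N by apply: (stair_Y2 st); lia.
by nia.
Qed.

Lemma in_semigroup_sg g : in_semigroup H g <-> sg g.
Proof.
split=> [[s /in_KW_sg sgs ->] //|sgg].
have g0 := stair_sg_ge0 sgg; exists `|g|%N; last by lia.
by apply/in_KW_sg; rewrite gez0_abs.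
Qed.

Definition arith_coefs (x y : nat) : Prop := [/\ (0 < x)%N, (0 < y)%N &
  forall i, (1 <= i <= m)%N -> X i = (i * x)%N /\ Y i = ((m.+1 - i) * y)%N].

(** By [stair_unique] the presentation hidden in [KWD_integers] agrees with the given one. *)
Lemma KWD_integersP x y : KWD_integers p q m.+2 H x y <-> arith_coefs x y.
Proof.
rewrite /KWD_integers subn2 subn1 /=; split.
  case=> x0 y0 xq yp [xs' [ys' [hH' E]]]; split=> // i im.
  have st' : staircase p q m (stairX q m xs') (stairY p m ys').
    by apply: (in_KW_staircase _ pq cpq hH'); lia.
  have [] := stair_unique st st' _ im.
    move=> s; split.
      move/in_KW_sg; case: hH' => _ _ _ Hs _.
      by move/Hs/(monoid_gen_stair st').
    move/(monoid_gen_stair st') => Hs'; apply/in_KW_sg.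
    by case: hH' => _ _ _ Hs _; apply/Hs.
  by rewrite !stairXE // !stairYE // => -> ->; apply: E.
case=> x0 y0 E; split=> //.
- have [<- _] := E m ltac:(lia); exact: (stair_X2 st).
- have := @stair_Y2 _ _ _ _ _ st 1 isT.
  by have [_ ->] := E 1%N ltac:(lia); rewrite subn1.
- exists xs, ys; split=> // i im.
  by have := E i im; rewrite !stairXE // !stairYE.
Qed.

Hypothesis nb : m = 1%N -> (2 * X 1 <> q)%N /\ (2 * Y 1 <> p)%N.

Lemma PF_corner g : PF H g <->
  exists2 j : nat, (j <= m)%N & g = pt ((X j)%:Z + 1) ((Y j.+1)%:Z + 1).
Proof.
rewrite -(stair_PF st _ nb) /PF; split=> -[ni gs]; split.
- by move/in_semigroup_sg.
- by move=> s /in_KW_sg Hs s0; apply/in_semigroup_sg/gs.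
- by move/in_semigroup_sg.
- by move=> s /in_KW_sg Hs s0; apply/in_semigroup_sg/gs.
Qed.

Section Arith.
Variables (x y : nat).
Hypothesis xyE : arith_coefs x y.

(** For m >= 2 this follows from m + 1 < 2 m; for m = 1 strictness is exactly the excluded
    boundary. *)
Lemma arith_coefs_bounds : (m.+1 * x < q)%N /\ (m.+1 * y < p)%N.
Proof.
case: xyE => x0 y0 E.
have [Xm _] := E m ltac:(lia); have [X1 Y1] := E 1%N ltac:(lia).
have := stair_X2 st (leqnn m); have := @stair_Y2 _ _ _ _ _ st 1 isT.
rewrite Xm Y1 => py qx.
have [m1|m2] : m = 1%N \/ (2 <= m)%N by lia.
  by have [] := nb m1; rewrite X1 Y1; rewrite m1 in py qx *; lia.
by split; nia.
Qed.

Lemma PF_arith_coefs g : PF H g <-> exists2 i : nat, (0 <= i <= m)%N &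
  g = p%:Z * q%:Z - (i%:Z * x%:Z + 1) * p%:Z - ((m.+2%:Z - i%:Z - 2) * y%:Z + 1) * q%:Z.
Proof.
have [x0 y0 E] := xyE.
have XE i : (i <= m)%N -> (X i)%:Z = i%:Z * x%:Z.
  by case: i => [|i] im; [rewrite (stair_X0 st)|have [-> _] := E i.+1 im; rewrite PoszM].
have YE i : (i <= m)%N -> (Y i.+1)%:Z = (m.+2%:Z - i%:Z - 2) * y%:Z.
  rewrite leq_eqVlt => /orP[/eqP ->|im]; first by rewrite (stair_Ym st); lia.
  have [_ ->] := E i.+1 im; rewrite PoszM; congr (_ * _); lia.
rewrite PF_corner; split=> -[i im ->]; exists i => //.
  by rewrite XE // YE.
by rewrite XE // YE.
Qed.

Lemma arith_coefs_neq : (x * p)%N%:Z - (y * q)%N%:Z != 0.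
Proof.
have [x0 y0 _] := xyE; have [xq yp] := arith_coefs_bounds.
apply/eqP => E; have E' : x%:Z * p%:Z + (- y%:Z) * q%:Z = 0 by lia.
have [|] := coord_uniq cpq (stair_q st) E'; last by lia.
by apply/orP; left; nia.
Qed.

Lemma PF_progression : exists z k : int,
  [/\ 0 <= z, 0 < k &
    forall g : int, PF H g <->
      exists2 j : nat, (1 <= j <= m.+1)%N & g = z + j%:Z * k].
Proof.
have [x0 y0 _] := xyE; have [xq yp] := arith_coefs_bounds.
have neq := arith_coefs_neq.
have [gt|lt] : (y * q)%N%:Z < (x * p)%N%:Z \/ (x * p)%N%:Z < (y * q)%N%:Z by lia.
  (* This z is the least pseudo-Frobenius number, here the one with i = m, minus k; written so, z >=
     0 follows from (m + 1) x < q and y >= 1. In the other case the least one has i = 0. *)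
  exists (p%:Z * (q%:Z - m.+1%:Z * x%:Z - 1) + (y%:Z - 1) * q%:Z).
  exists (x%:Z * p%:Z - y%:Z * q%:Z); split; [nia|lia|].
  move=> g; rewrite PF_arith_coefs; split=> -[j jm ->].
    exists (m.+1 - j)%N; first by lia.
    by rewrite -subzn; [rewrite -(addn1 m.+1) -(addn1 m) !PoszD; ring|lia].
  exists (m.+1 - j)%N; first by lia.
  by rewrite -subzn; [rewrite -(addn1 m.+1) -(addn1 m) !PoszD; ring|lia].
exists (q%:Z * (p%:Z - m.+1%:Z * y%:Z - 1) + (x%:Z - 1) * p%:Z).
exists (y%:Z * q%:Z - x%:Z * p%:Z); split; [nia|lia|].
move=> g; rewrite PF_arith_coefs; split=> -[j jm ->].
  exists j.+1; first by lia.
  by rewrite -(addn1 m.+1) -(addn1 m) -(addn1 j) !PoszD; ring.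
exists j.-1; first by lia.
have -> : j.-1%:Z = j%:Z - 1 by lia.
by rewrite -(addn1 m.+1) -(addn1 m) !PoszD; ring.
Qed.

Lemma PF_progression_diff (z k : int) : 0 < k ->
  (forall g : int, PF H g <->
     exists2 j : nat, (1 <= j <= m.+1)%N & g = z + j%:Z * k) ->
  k = `|x%:Z * p%:Z - y%:Z * q%:Z|.
Proof.
move=> k0 PFE; rewrite distrC.
apply: (@arith_progression_diff m (pt 1 (m%:Z * y%:Z + 1)) _ z) => // g.
rewrite -PFE PF_arith_coefs; split=> -[j jm ->]; exists j => //.
  by rewrite -(addn1 m.+1) -(addn1 m) !PoszD; ring.
by rewrite -(addn1 m.+1) -(addn1 m) !PoszD; ring.
Qed.

End Arith.

Lemma progression_arith_coefs (z k : int) : 0 < k ->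
  (forall g : int, PF H g <->
     exists2 j : nat, (1 <= j <= m.+1)%N & g = z + j%:Z * k) ->
  exists x y, arith_coefs x y.
Proof.
move=> k0 PFE.
(* The e_j are the pseudo-Frobenius numbers plus p + q; the extra k accounts for a progression
   indexed from 1 where [stair_arith] starts at 0. *)
have [|t tm|x [y [x0 y0 E]]] := @stair_arith _ _ _ _ _ st (z + p%:Z + q%:Z + k) k.
- exact: lt0r_neq0.
- have /PF_corner [j jm jE] : PF H (z + t.+1%:Z * k) by apply/PFE; exists t.+1.
  exists j => //; rewrite -(addn1 t) PoszD in jE.
  have -> : z + p%:Z + q%:Z + k + t%:Z * k = z + (t%:Z + 1) * k + p%:Z + q%:Z by ring.
  by rewrite jE; ring.
- by exists x, y.
Qed.

End Presented.

(* For n = 3 the boundary cases x_1 = q/2 and y_1 = p/2 are excluded: there the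
   equivalence fails, e.g. for H = <4,5,6> (p = 4, q = 5, x_1 = 1, y_1 = 2),
   which is symmetric with PF(H) = {7}. *)
Theorem theorem1p4 (K : fieldType) (p q n : nat) (xs ys : nat -> nat)
    (H : nat -> Prop)
    (hp : (3 <= p)%N) (hpq : (p < q)%N) (hcop : coprime p q)
    (hH : in_KW p q n xs ys H)
    (hbd : n = 3%N -> (2 * xs 1 <> q)%N /\ (2 * ys 1 <> p)%N) :
  let I_H := defining_ideal (K := K) (@KWgens p q n xs ys) in
  let PF_arith (z k : int) :=
    [/\ 0 <= z, 0 < k &
        forall g : int, PF H g <->
          exists2 j : nat, (1 <= j <= n - 1)%N & g = z + j%:Z * k] in
  [<-> in_KWD p q n H;
       exists x y : nat,
         [/\ (0 < x)%N, (0 < y)%N,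
             (2 * ((n - 2) * y) <= p)%N, (2 * ((n - 2) * x) <= q)%N &
             forall f : {mpoly K[n]},
               I_H f <-> ideal_gen (minor2 (KWD_matrix K p q n x y)) f];
       exists F G : 'I_n -> {mpoly K[n]},
         [/\ forall j, whomog (@KWgens p q n xs ys) (F j) /\
                       whomog (@KWgens p q n xs ys) (G j),
             forall j, irrelevant_ideal (F j) /\ irrelevant_ideal (G j) &
             forall f : {mpoly K[n]},
               I_H f <-> ideal_gen (minor2 (two_rows F G)) f];
       exists z k : int, PF_arith z k]
  /\
  forall x y : nat, KWD_integers p q n H x y ->
    (forall g : int, PF H g <->
       exists2 i : nat, (0 <= i <= n - 2)%N &
         g = p%:Z * q%:Z - (i%:Z * x%:Z + 1) * p%:Z
             - ((n%:Z - i%:Z - 2) * y%:Z + 1) * q%:Z)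
    /\
    forall z k : int, PF_arith z k -> k = `|x%:Z * p%:Z - y%:Z * q%:Z|.
Proof.
have [m nE] : exists m, n = m.+2.
  by case: hH => n3 _ _ _ _; exists (n - 2)%N; lia.
subst n; rewrite subn2 subn1 /=.
have st : staircase p q m (stairX q m xs) (stairY p m ys).
  by apply: (in_KW_staircase _ hpq hcop hH); lia.
have m0 := stair_m st.
have X1 : stairX q m xs 1 = xs 1 by rewrite stairXE.
have Y1 : stairY p m ys 1 = ys 1 by rewrite stairYE.
have nb : m = 1%N -> (2 * stairX q m xs 1 <> q)%N /\ (2 * stairY p m ys 1 <> p)%N.
  by move=> m1; rewrite X1 Y1; apply: hbd; rewrite m1.
have c4 := PF_progression hp hpq hcop hH nb.
have c1 := progression_arith_coefs hp hpq hcop hH nb.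
split; last first.
  move=> x y /(KWD_integersP hp hpq hcop hH) xyE; split.
    exact: (PF_arith_coefs hp hpq hcop hH nb xyE).
  by move=> z k [_ k0 PFE]; apply: (PF_progression_diff hp hpq hcop hH nb xyE k0 PFE).
have qx x y : arith_coefs p q m xs ys x y ->
    (2 * (m * y) <= p)%N /\ (2 * (m * x) <= q)%N.
  case=> x0 y0 E; have [Xm _] := E m ltac:(lia); have [_ Y1'] := E 1%N ltac:(lia).
  have := stair_X2 st (leqnn m); have := @stair_Y2 _ _ _ _ _ st 1 isT.
  by rewrite Xm Y1' subn1.
tfae.
- case=> x [y /(KWD_integersP hp hpq hcop hH) xyE]; exists x, y.
  have [py qx'] := qx _ _ xyE; have [x0 y0 E] := xyE.
  by split=> // f; apply: (KWD_generation st E m0).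
- case=> x [y [x0 y0 py qx' gen]].
  have [X1x Y1y] := KWD_matrix_first st m0 py y0 (fun f Hf => (gen f).2 Hf).
  (* Strictness makes the exponent of u in the first column positive, so that this entry lies in the
     irrelevant ideal; [yp] does the same for v. *)
  have xq : (m.+1 * x < q)%N.
    have [m1|m2] : m = 1%N \/ (2 <= m)%N by lia.
      by have [] := nb m1; rewrite X1x Y1y m1 in qx' *; lia.
    by nia.
  have yp : (m.+1 * y < p)%N.
    have [m1|m2] : m = 1%N \/ (2 <= m)%N by lia.
      by have [] := nb m1; rewrite X1x Y1y m1 in py *; lia.
    by nia.
  exists (@KWD_top K p m x y), (@KWD_bot K q m x y); split.
  + by move=> j; split; [apply: (KWD_top_entry K _ m0 x0 y0 xq yp j).1|apply: (KWD_bot_entry K _ m0 x0 y0 xq yp j).1].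
  + by move=> j; split; [apply: (KWD_top_entry K _ m0 x0 y0 xq yp j).2|apply: (KWD_bot_entry K _ m0 x0 y0 xq yp j).2].
  + by move=> f; rewrite gen KWD_matrixE.
- case=> F [G [hom irr gen]].
  have [x [y xyE]] : exists x y, arith_coefs p q m xs ys x y; last exact: (c4 x y xyE).
  have [m1|m2] : m = 1%N \/ (2 <= m)%N by lia.
    exists (stairX q m xs 1), (stairY p m ys 1); split.
    + by have := stair_X st (ltnSn 0) (ltnW m0); rewrite (stair_X0 st).
    + by have := @stair_Y _ _ _ _ _ st 1 m.+1 m0 (leqnn _); rewrite (stair_Ym st).
    + move=> i im; have -> : i = 1%N by lia.
      by rewrite m1 !mul1n.
  have [z [k [k0 AP]]] := determinantal_arith st m2 hom irr gen.
  have [x [y [x0 y0 E]]] := stair_arith st k0 AP.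
  by exists x, y.
- case=> z [k [_ k0 PFE]]; have [x [y xyE]] := c1 z k k0 PFE.
  by exists x, y; apply/(KWD_integersP hp hpq hcop hH).
Qed.
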